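(* Assume that: (i) $(\varepsilon_t)$ and $(\eta_t)$ are mutually independent strong white noises with $\mathbb{E}[\ln^+|\varepsilon_0|]<\infty$ and $\mathbb{E}[\ln|\theta+\alpha\,\eta_0+\eta_1|]<0$; (ii) $\sigma_{2k+1}=\tau_{2k+1}=0$ for any $k\in\mathbb{N}$ such that the moments exist; (iii) $\sigma_2>0$, $\tau_2>0$, $\sigma_2<\infty$, $\tau_4<\infty$ and $\rho(M)<1$. Then $(X_t)$ is a strictly and second-order stationary process with mean zero and autocovariance function given, for $h\in\mathbb{Z}$, by $$\gamma_X(h)=\sigma_2\,\big[N^{|h|}(I_3-M)^{-1}U_0\big]_1 .$$ Its autocorrelation function is $\rho_X(h)=\gamma_X(h)/\gamma_X(0)$. In addition, $(X_t)$ is the unique causal, ergodic, strictly and second-order stationary solution of $X_t=\theta_tX_{t-1}+\varepsilon_t$, $\theta_t=\theta+\alpha\,\eta_{t-1}+\eta_t$.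
   Context: $\theta,\alpha\in\mathbb{R}$ are fixed parameters; $(\varepsilon_t)_{t\in\mathbb{Z}}$, $(\eta_t)_{t\in\mathbb{Z}}$ are real random sequences; $\sigma_a=\mathbb{E}[\varepsilon_0^{\,a}]$, $\tau_a=\mathbb{E}[\eta_0^{\,a}]$. A strong white noise is an i.i.d. sequence; $\ln^+x=\max(\ln x,0)$; $\rho(\cdot)$ of a square matrix is its spectral radius; $[v]_i$ is the $i$-th entry of a vector $v$; $I_p$ is the identity matrix of order $p$. $(X_t)_{t\in\mathbb{Z}}$ is the process $X_t=\varepsilon_t+\sum_{k\ge1}\varepsilon_{t-k}\prod_{\ell=0}^{k-1}\theta_{t-\ell}$, where $\theta_t=\theta+\alpha\,\eta_{t-1}+\eta_t$, which under (i) is an almost surely convergent, strictly stationary and ergodic causal solution of $X_t=\theta_tX_{t-1}+\varepsilon_t$. A solution $(W_t)$ is causal if $W_t=\varphi((\varepsilon_t,\eta_t),(\varepsilon_{t-1},\eta_{t-1}),\ldots)$ for some measurable $\varphi$ not depending on $t$. Uniqueness is up to almost sure equality. $$U_0=\begin{pmatrix}1\\0\\\tau_2\end{pmatrix},\quad M=\begin{pmatrix}\theta^2+\tau_2&2\alpha\theta&\alpha^2\\2\theta\tau_2&2\alpha\tau_2&0\\\theta^2\tau_2+\tau_4&2\alpha\theta\tau_2&\alpha^2\tau_2\end{pmatrix},\quad N=\begin{pmatrix}\theta&\alpha&0\\\tau_2&0&0\\\theta\tau_2&\alpha\tau_2&0\end{pmatrix}.$$ *)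

(* Defs.v *)
From mathcomp Require Export all_boot all_order all_algebra.
From mathcomp Require Export complex.
From mathcomp Require Export all_classical all_reals all_analysis.

Set Implicit Arguments.
Unset Strict Implicit.
Unset Printing Implicit Defensive.

Import Order.TTheory GRing.Theory Num.Theory numFieldNormedType.Exports.
Local Open Scope classical_set_scope.
Local Open Scope ring_scope.

(* The product sigma-algebra on I -> T is the one generated by the
   one-coordinate cylinders. *)
Definition cylinder (I : Type) d (T : measurableType d) : set (set (I -> T)) :=
  [set C | exists i, exists2 A, measurable A & C = [set x | A (x i)]].

Definition pathType (I : Type) d (T : measurableType d) :=
  g_sigma_algebraType (@cylinder I d T).

Section Processes.
Context {R : realType} {d : measure_display} {Omega : measurableType d}.
Variable P : probability Omega R.
Implicit Types W : int -> Omega -> R.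

Definition trajectory W (w : Omega) : pathType int R := fun t => W t w.

Definition identically_distributed W :=
  forall (s t : int) (A : set R), measurable A ->
    P (W s @^-1` A) = P (W t @^-1` A).

Definition mutually_independent W :=
  forall (s : seq int) (A : int -> set R), uniq s ->
    (forall t, measurable (A t)) ->
    P (\bigcap_(t in [set` s]) (W t @^-1` A t))
    = (\prod_(t <- s) P (W t @^-1` A t))%E.

Definition strong_white_noise W :=
  [/\ forall t, measurable_fun setT (W t),
      mutually_independent W & identically_distributed W].

Definition independent_processes W W' :=
  forall C D : set (pathType int R), measurable C -> measurable D ->
    P (trajectory W @^-1` C `&` trajectory W' @^-1` D)
    = (P (trajectory W @^-1` C) * P (trajectory W' @^-1` D))%E.

Definition path_shift (h : int) (x : pathType int R) : pathType int R :=
  fun t => x (t + h).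

Definition strictly_stationary W :=
  (forall t, measurable_fun setT (W t)) /\
  forall (h : int) (C : set (pathType int R)), measurable C ->
    P (trajectory W @^-1` (path_shift h @^-1` C)) = P (trajectory W @^-1` C).

Definition ergodic W :=
  forall C : set (pathType int R), measurable C ->
    path_shift 1 @^-1` C = C ->
    P (trajectory W @^-1` C) = 0%E \/ P (trajectory W @^-1` C) = 1%E.

Definition second_order_stationary W :=
  [/\ forall t, W t \in Lfun P 2%:E,
      forall s t : int, ('E_P[W s] = 'E_P[W t])%E &
      forall s t h : int,
        covariance P (W s) (W (s + h)) = covariance P (W t) (W (t + h))].

Definition correlation (Y Z : Omega -> R) : R :=
  fine (covariance P Y Z) /
  (Num.sqrt (fine (variance P Y)) * Num.sqrt (fine (variance P Z))).

Definition moment (Y : Omega -> R) (a : nat) : \bar R :=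
  'E_P[fun w => (Y w ^+ a)%R]%E.

Definition odd_moments_zero (Y : Omega -> R) :=
  forall k : nat,
    P.-integrable setT (fun w => (Y w ^+ (2 * k + 1))%:E) ->
    moment Y (2 * k + 1) = 0%E.

(* ln 0 = 0 in the library, so this takes the correct value 0 at x = 0. *)
Definition lnp (x : R) : R := Num.max (ln x) 0.

Section Model.
Variables (theta alpha : R) (eps eta : int -> Omega -> R).

Definition theta_ (t : int) (w : Omega) : R :=
  theta + alpha * eta (t - 1) w + eta t w.

Definition Xterm (t : int) (w : Omega) (k : nat) : R :=
  eps (t - k%:Z) w * \prod_(0 <= l < k) theta_ (t - l%:Z) w.

Definition Xpartial (t : int) (w : Omega) (n : nat) : R :=
  \sum_(1 <= k < n) Xterm t w k.

(* The limit defaults to 0 at the points w where the series diverges. *)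
Definition X_ (t : int) (w : Omega) : R :=
  eps t w + limn (Xpartial t w).

Definition solution W :=
  forall t : int,
    {ae P, forall w, W t w = theta_ t w * W (t - 1) w + eps t w}.

Definition causal W :=
  exists2 phi : pathType nat (R * R)%type -> R, measurable_fun setT phi &
    forall t : int,
      {ae P, forall w,
        W t w = phi (fun k : nat => (eps (t - k%:Z) w, eta (t - k%:Z) w))}.

End Model.
End Processes.

Section Matrices.
Context {R : realType}.

(* For n >= 1 this set is finite and nonempty, so sup is a maximum. *)
Definition spectral_radius n (A : 'M[R]_n) : R :=
  sup [set r | exists2 z : R[i],
         eigenvalue (map_mx (real_complex R) A) z & r = ComplexField.Normc.normc z].

Definition matrix_of_rows m n (s : seq (seq R)) : 'M[R]_(m, n) :=
  \matrix_(i < m, j < n) nth 0 (nth [::] s i) j.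

Variables (theta alpha tau2 tau4 : R).

Definition U0_ : 'cV[R]_3 :=
  matrix_of_rows 3 1 [:: [:: 1]; [:: 0]; [:: tau2]].

Definition M_ : 'M[R]_3 := matrix_of_rows 3 3
  [:: [:: theta ^+ 2 + tau2; 2 * alpha * theta; alpha ^+ 2];
      [:: 2 * theta * tau2; 2 * alpha * tau2; 0];
      [:: theta ^+ 2 * tau2 + tau4; 2 * alpha * theta * tau2;
          alpha ^+ 2 * tau2]].

Definition N_ : 'M[R]_3 := matrix_of_rows 3 3
  [:: [:: theta; alpha; 0];
      [:: tau2; 0; 0];
      [:: theta * tau2; alpha * tau2; 0]].

Definition gamma_ (sigma2 : R) (h : int) : R :=
  sigma2 * (N_ ^+ `|h|%N *m invmx (1%:M - M_) *m U0_) 0 0.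

End Matrices.

(* Main.v *)
From HB Require Import structures.
From mathcomp Require Import measurable_realfun ring lra zify.
Require Import Defs.

(** The partial sums x_n(t) of the series defining X_t satisfy
    x_(n+1)(t) = theta_t x_n(t-1) + eps_t.  For Q measurable with respect to the
    past up to time t, put m_t(Q) = E[Q (1, eta_t, eta_t^2)].  Expanding
    theta_(t+1) = theta + alpha eta_t + eta_(t+1) and using independence gives
    m_(t+1)(Q theta_(t+1)^2) = M m_t(Q) and m_(t+1)(Q theta_(t+1)) = N m_t(Q), so
    the second moments of the terms are sigma_2 [M^k U_0]_1 and
    E[x_n(t) x_(n+h)(t+h)] = [N^h v_n]_1 with v_(n+1) = M v_n + sigma_2 U_0.
    Cayley-Hamilton turns rho(M) < 1 into geometric decay of M^k.  Hence for some
    q < 1 the envelope D_t = sum_k q^(-k) (k-th term)^2 is integrable, and by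
    Cauchy-Schwarz x_n(t)^2 <= D_t / (1 - q): this gives almost sure convergence
    and dominates the passage to the limit in all the moments.  Stationarity and
    ergodicity come from the shift on the path space of the noise, which preserves
    the law and is mixing.  Finally two solutions differ by a product of
    coefficients, which tends to 0 in mean square, times a difference bounded in
    mean square. *)

Set Implicit Arguments.
Unset Strict Implicit.
Unset Printing Implicit Defensive.

Import Order.TTheory GRing.Theory Num.Theory numFieldNormedType.Exports.
Import ComplexField.Normc.
Local Open Scope classical_set_scope.
Local Open Scope ring_scope.

(** * Spectral radius *)

Section SpectralRadius.
Context {R : realType}.

(** The characteristic polynomial has finitely many roots, so the supremum in [spectral_radius]
    bounds every modulus. The midpoint between it and 1 leaves a strict margin, and the maximum with
    0 makes [rho] positive. *)
Lemma spectral_radius_lt1_roots n (A : 'M[R]_n) :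
  spectral_radius A < 1 ->
  exists2 rho : R, 0 < rho < 1 & forall z,
    root (char_poly (map_mx (real_complex R) A)) z -> normc z < rho.
Proof.
move=> rho1; set B := map_mx _ A.
have [s Bs] := closed_field_poly_normal (char_poly B).
rewrite (monicP (char_poly_monic _)) scale1r in Bs.
exists ((1 + Num.max 0 (spectral_radius A)) / 2).
  by case: (lerP 0 (spectral_radius A)) => ?; apply/andP; split; lra.
move=> z zB; suff : normc z <= spectral_radius A.
  by case: (lerP 0 (spectral_radius A)) => ? ?; lra.
apply: ub_le_sup; last first.
  by exists z => //; rewrite eigenvalue_root_char.
(* The sum of all the moduli bounds each one, so the set is bounded above and its supremum is an
   upper bound. *)
exists (\sum_(x <- s) normc x) => _ [x xB ->].
move: xB; rewrite eigenvalue_root_char -/B Bs root_prod_XsubC => xs.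
rewrite (big_rem x)//= lerDl sumr_ge0// => y _.
by rewrite /normc; case: y => *; exact: sqrtr_ge0.
Qed.

(** The bound propagates by induction as soon as [C + normc z * D <= D * rho], which can be solved
    for [D] because [normc z < rho]. This serves to remove one linear factor of the characteristic
    polynomial. *)
Lemma affine_recursion_geometric (z : R[i]) (rho : R) (a b : nat -> R[i]) (C : R) :
  0 < rho -> normc z < rho -> (forall k, a k.+1 = z * a k + b k) ->
  (forall k, normc (b k) <= C * rho ^+ k) ->
  exists D, forall k, normc (a k) <= D * rho ^+ k.
Proof.
move=> rho0 zrho ab bC.
exists (Num.max (normc (a 0%N)) (C / (rho - normc z))).
have [zge0 age0] : 0 <= normc z /\ 0 <= normc (a 0%N).
  by split; rewrite /normc; [case: (z)|case: (a 0%N)] => *; exact: sqrtr_ge0.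
set D := Num.max _ _.
have D0 : normc (a 0%N) <= D by rewrite le_max lexx.
have D1 : C + normc z * D <= D * rho.
  have : C / (rho - normc z) <= D by rewrite le_max lexx orbT.
  by rewrite ler_pdivrMr ?subr_gt0//; lra.
elim=> [|k IH]; first by rewrite expr0 mulr1.
rewrite ab (le_trans (le_normcD _ _))// normcM.
rewrite exprS mulrA.
apply: (le_trans (lerD (ler_wpM2l zge0 IH) (bC k))).
rewrite mulrA -mulrDl ler_wpM2r ?exprn_ge0 ?(ltW rho0)//; lra.
Qed.

(** By Cayley-Hamilton the product of all factors X - z vanishes at [B], so [geom] holds trivially
    for it. Each factor is then removed by an affine recursion with multiplier z, until the
    polynomial 1 is reached; no Jordan form is involved. *)
Lemma spectral_radius_lt1_geometric n (A : 'M[R]_n.+1) :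
  spectral_radius A < 1 ->
  exists C rho : R, [/\ 0 < C, 0 < rho < 1 &
    forall k i j, `|(A ^+ k) i j| <= C * rho ^+ k].
Proof.
move=> /spectral_radius_lt1_roots; set B := map_mx _ A => -[rho rho01 Brho].
have /andP[rho0 rho1] := rho01.
have [s Bs] := closed_field_poly_normal (char_poly B).
rewrite (monicP (char_poly_monic _)) scale1r in Bs.
have srho z : z \in s -> normc z < rho.
  by move=> zs; apply: Brho; rewrite Bs root_prod_XsubC.
pose geom (p : {poly R[i]}) := forall i j, exists C, forall k,
  normc ((horner_mx B p * B ^+ k) i j) <= C * rho ^+ k.
have geom1 : geom 1.
  have : geom (\prod_(z <- s) ('X - z%:P)).
    move=> i j; exists 0 => k; rewrite -Bs Cayley_Hamilton mul0r mxE normc0.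
    by rewrite mul0r.
  elim: s srho {Bs} => [|z s IH] srho; first by rewrite big_nil.
  rewrite big_cons => gp; apply: IH => [x xs|].
    by apply: srho; rewrite in_cons xs orbT.
  move=> i j; have [C gC] := gp i j.
  apply: (@affine_recursion_geometric z rho _ _ C rho0 _ _ gC).
    by apply: srho; rewrite mem_head.
  move=> k; set Q := horner_mx B (\prod_(y <- s) ('X - y%:P)).
  suff -> : Q * B ^+ k.+1 = z *: (Q * B ^+ k) +
      horner_mx B (('X - z%:P) * \prod_(y <- s) ('X - y%:P)) * B ^+ k.
    by rewrite mxE [in LHS]mxE.
  rewrite rmorphM/= rmorphB/= horner_mx_X horner_mx_C -/Q.
  rewrite mulrBl mulrBl -[z%:M]scalemx1 -!scalerAl mul1r addrC subrK.
  rewrite exprS mulrA; congr (_ * _).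
  exact/commr_sym/comm_mx_horner.
pose C i j := sval (cid (geom1 i j)).
(* The constants in [geom] depend on the entry; the sum of their absolute values serves all entries,
   and the added 1 makes it positive. *)
exists (1 + \sum_i \sum_j `|C i j|), rho; split=> //.
  by rewrite ltr_wpDr// sumr_ge0// => i _; rewrite sumr_ge0.
move=> k i j.
have := svalP (cid (geom1 i j)) k; rewrite -/(C i j) rmorph1 mul1r.
have -> : B ^+ k = map_mx (real_complex R) (A ^+ k).
  by rewrite rmorphXn.
rewrite mxE /normc/= expr0n/= addr0 sqrtr_sqr => /le_trans; apply.
rewrite ler_wpM2r// ?exprn_ge0 ?(ltW rho0)// (le_trans (ler_norm _))//.
rewrite (bigD1 i)//= (bigD1 j)//=.
have := @sumr_ge0 _ _ (index_enum _) (fun j0 => j0 != j) (fun j => `|C i j|).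
move=> /(_ (fun _ _ => normr_ge0 _)).
have := @sumr_ge0 _ _ (index_enum _) (fun i0 => i0 != i)
  (fun i => \sum_j `|C i j|).
move=> /(_ (fun _ _ => sumr_ge0 _ (fun _ _ => normr_ge0 _))).
by lra.
Qed.

(** If [1%:M - A] were singular, 1 would be an eigenvalue of [A], of modulus 1. *)
Lemma spectral_radius_lt1_unitmx n (A : 'M[R]_n.+1) :
  spectral_radius A < 1 -> 1%:M - A \in unitmx.
Proof.
move=> /spectral_radius_lt1_roots[rho /andP[rho0 rho1]] Brho.
apply: contraT; rewrite unitmxE unitfE negbK => /eqP det0.
have : normc (1 : R[i]) < rho.
  apply: Brho; rewrite -eigenvalue_root_char -(rmorph1 (real_complex R)).
  rewrite eigenvalue_map /eigenvalue kermx_eq0 row_free_unit unitmxE unitfE.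
  by rewrite -opprB -scaleN1r detZ det0 mulr0 eqxx.
by rewrite normc1; lra.
Qed.

End SpectralRadius.

(** * Means *)

Section Mean.
Context {R : realType} {d : measure_display} {T : measurableType d}.
Variable P : probability T R.
Implicit Types (f g : T -> R) (a b : R).

(** Integrability travels together with the value, so that moments are computed by composing such
    statements without separate integrability obligations. *)
Definition has_mean f a :=
  P.-integrable setT (EFin \o f) /\ (\int[P]_w (f w)%:E = a%:E)%E.

Lemma eq_has_mean f g a : has_mean f a -> f =1 g -> has_mean g a.
Proof. by move=> + /funext <-. Qed.

Lemma has_mean_measurable f a : has_mean f a -> measurable_fun setT f.
Proof. by move=> [/measurable_int/measurable_EFinP]. Qed.

Lemma has_mean_expectation f a : has_mean f a -> ('E_P[f] = a%:E)%E.
Proof. by move=> [_ fa]; rewrite unlock. Qed.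

Lemma has_mean_Lfun1 f a : has_mean f a -> f \in Lfun P 1.
Proof. by move=> [fi _]; exact/Lfun1_integrable. Qed.

Lemma integrable_has_mean f :
  P.-integrable setT (EFin \o f) -> has_mean f (fine 'E_P[f]).
Proof.
by move=> fi; split=> //; rewrite unlock fineK//; exact: integrable_fin_num.
Qed.

Lemma has_meanD f g a b :
  has_mean f a -> has_mean g b -> has_mean (f \+ g) (a + b).
Proof.
move=> [fi fa] [gi gb]; split; first by exact: (integrableD measurableT fi gi).
by under eq_integral do rewrite EFinD; rewrite integralD//= fa gb.
Qed.

Lemma has_meanZ f a k : has_mean f a -> has_mean (fun w => k * f w) (k * a).
Proof.
move=> [fi fa]; split; first exact: (integrableZl measurableT k fi).
by under eq_integral do rewrite EFinM; rewrite integralZl//= fa.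
Qed.

Lemma has_mean_cst k : has_mean (cst k) k.
Proof.
split; first exact: finite_measure_integrable_cst.
by have := expectation_cst P k; rewrite unlock.
Qed.

End Mean.

Section SameLaw.
Context {R : realType} {d : measure_display} {T : measurableType d}.
Variable P : probability T R.

(** Both integrals are integrals of [f] against one image measure; the nonnegative case, applied to
    the absolute value of [f], gives integrability first. *)
Lemma has_mean_same_law d' (T' : measurableType d') (U V : T -> T') (f : T' -> R) a :
  measurable_fun setT U -> measurable_fun setT V -> measurable_fun setT f ->
  (forall A, measurable A -> P (U @^-1` A) = P (V @^-1` A)) ->
  has_mean P (f \o U) a -> has_mean P (f \o V) a.
Proof.
move=> mU mV mf UV.
pose U' : {mfun T >-> T'} := HB.pack U (isMeasurableFun.Build _ _ _ _ U mU).
pose V' : {mfun T >-> T'} := HB.pack V (isMeasurableFun.Build _ _ _ _ V mV).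
have mEf : measurable_fun setT (EFin \o f) by exact/measurable_EFinP.
have UV' A : measurable A -> distribution P U' A = distribution P V' A.
  exact: UV.
have ge0E (g : T' -> \bar R) : measurable_fun setT g -> (forall x, 0 <= g x)%E ->
    (\int[P]_w g (V w) = \int[P]_w g (U w))%E.
  move=> mg g0.
  rewrite -(@ge0_integral_distribution _ _ _ _ _ P U' g)//.
  rewrite -(@ge0_integral_distribution _ _ _ _ _ P V' g)//.
  by apply: eq_measure_integral => A mA _; exact/esym/UV'.
move=> [/integrableP[mi fi] fa].
have Vi : P.-integrable setT (EFin \o (f \o V)).
  apply/integrableP; split.
    by apply/measurable_EFinP; exact: measurableT_comp.
  rewrite (ge0E (fun x => `|(f x)%:E|)%E)//.
  exact: measurableT_comp.
split=> //.
rewrite -[LHS](@integral_distribution _ _ _ _ _ P V' (EFin \o f))//.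
transitivity (\int[distribution P U']_y (f y)%:E)%E.
  by apply: eq_measure_integral => A mA _; exact/esym/UV'.
rewrite (@integral_distribution _ _ _ _ _ P U' (EFin \o f))//.
by apply/integrableP; split.
Qed.

(** Independence identifies the joint law of [U] and [V] with the product of their laws, by
    uniqueness of the product measure; Fubini then factors the integral of x y. *)
Lemma has_meanM_independent (U V : T -> R) a b :
  (forall A B, measurable A -> measurable B ->
    P (U @^-1` A `&` V @^-1` B) = (P (U @^-1` A) * P (V @^-1` B))%E) ->
  has_mean P U a -> has_mean P V b -> has_mean P (U \* V) (a * b).
Proof.
move=> UV Ua Vb.
have mU := has_mean_measurable Ua; have mV := has_mean_measurable Vb.
pose U' : {mfun T >-> R} := HB.pack U (isMeasurableFun.Build _ _ _ _ U mU).
pose V' : {mfun T >-> R} := HB.pack V (isMeasurableFun.Build _ _ _ _ V mV).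
pose W w := (U w, V w).
have mW : measurable_fun setT W by exact: measurable_fun_pair.
pose W' : {mfun T >-> (R * R)%type} :=
  HB.pack W (isMeasurableFun.Build _ _ _ _ W mW).
pose mu := distribution P U'; pose nu := distribution P V'.
have WE X : measurable X -> (mu \x nu)%E X = distribution P W' X.
  apply: product_measure_unique => A B mA mB.
  by rewrite /mu /nu /distribution /pushforward/= -UV.
pose f (x : R * R) := (x.1 * x.2)%R.
have mf : measurable_fun setT (EFin \o f).
  by apply/measurable_EFinP; exact: measurable_funM.
have absE (X : T -> R) (X' : {mfun T >-> R}) : X = X' ->
    P.-integrable setT (EFin \o X) ->
    (\int[distribution P X']_y `|y%:E| < +oo)%E.
  move=> -> /integrableP[_]; rewrite ge0_integral_distribution//.
  exact: measurableT_comp.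
have idE (X : T -> R) (X' : {mfun T >-> R}) c : X = X' -> has_mean P X c ->
    (\int[distribution P X']_y y%:E = c%:E)%E.
  by move=> -> [Xi <-]; rewrite (@integral_distribution _ _ _ _ _ P X' EFin).
(* Fubini needs integrability under the product law, which Tonelli gives from the two first absolute
   moments. *)
have munu : (mu \x nu)%E.-integrable setT (EFin \o f).
  apply/integrable12ltyP => //=.
  rewrite (eq_integral (fun x : R => `|x%:E| * \int[nu]_y `|y%:E|)%E); last first.
    move=> x _; rewrite -ge0_integralZl//; last exact: measurableT_comp.
    by apply: eq_integral => y _; rewrite -abseM -EFinM.
  rewrite ge0_integralZr//.
  - rewrite lte_mul_pinfty//.
    + by apply: integral_ge0.
    + rewrite ge0_fin_numE; last exact: integral_ge0.
      exact: (absE U _ _ Ua.1).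
    + exact: (absE V _ _ Vb.1).
  - exact: measurableT_comp.
  - exact: integral_ge0.
have fW : (distribution P W').-integrable setT (EFin \o f).
  move/integrableP : munu => [_ fi]; apply/integrableP; split=> //.
  rewrite (le_lt_trans _ fi)// le_eqVlt; apply/orP; left; apply/eqP.
  by apply: eq_measure_integral => A mA _; exact/esym/WE.
have UVi : P.-integrable setT (EFin \o (U \* V)).
  move/integrableP : fW => [_]; rewrite ge0_integral_distribution//; last first.
    exact: measurableT_comp.
  by move=> fi; apply/integrableP; split=> //; apply/measurable_EFinP/measurable_funM.
split=> //.
rewrite -[LHS](@integral_distribution _ _ _ _ _ P W' (EFin \o f))//.
transitivity (\int[(mu \x nu)%E]_x (f x)%:E)%E.
  by apply: eq_measure_integral => A mA _; exact/esym/WE.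
rewrite -integral12_prod_meas1//.
rewrite /fubini_F.
transitivity (\int[mu]_x (x%:E * b%:E))%E.
  apply: eq_integral => x _ /=.
  under eq_integral do rewrite EFinM.
  rewrite integralZl//; first by rewrite (idE V _ b).
  apply/integrableP; split; first exact: EFin_measurable.
  exact: (absE V _ _ Vb.1).
rewrite integralZr//; first by rewrite (idE U _ a).
apply/integrableP; split; first exact: EFin_measurable.
exact: (absE U _ _ Ua.1).
Qed.

End SameLaw.

(** * Independent families *)

Section IndependentFamily.
Context {R : realType} {d : measure_display} {T : measurableType d}.
Variable P : probability T R.

Lemma measure_eq_pi_system (m1 m2 : {measure set T -> \bar R}) (G : set (set T)) :
  G `<=` measurable -> setI_closed G -> G setT -> (m1 setT < +oo)%E ->
  (forall A, G A -> m1 A = m2 A) -> forall A, <<s G >> A -> m1 A = m2 A.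
Proof.
move=> Gm GI GT m1oo m12.
apply: (g_sigma_algebra_measure_unique G Gm (fun=> setT)) => //.
by apply/seteqP; split=> // x _; exists 0%N.
Qed.

(** The restriction of [P] to [C] and the multiple of [P] by the mass of [C] are finite measures
    that agree on a pi-system. *)
Lemma independent_pi_system (G : set (set T)) (C : set T) :
  G `<=` measurable -> setI_closed G -> G setT -> measurable C ->
  (forall A, G A -> P (A `&` C) = (P A * P C)%E) ->
  forall A, <<s G >> A -> P (A `&` C) = (P A * P C)%E.
Proof.
move=> Gm GI GT mC GC A sA.
have PC0 : 0 <= fine (P C) by rewrite fine_ge0.
pose m1 : {measure set T -> \bar R} := mrestr P mC.
pose m2 : {measure set T -> \bar R} := mscale (NngNum PC0) P.
have PCE : (fine (P C))%:E = P C by rewrite fineK ?fin_num_measure.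
have m2E B : m2 B = (P B * P C)%E by rewrite -PCE muleC.
rewrite -m2E -[LHS]/(m1 A).
apply: (measure_eq_pi_system Gm GI GT) => // [|B GB].
  by rewrite -[m1 _]/(P (setT `&` C)) setTI -PCE ltry.
by rewrite m2E; exact: GC.
Qed.

Context {J : eqType}.
Variable z : J -> T -> R.

Definition box (s : seq J) (A : J -> set R) : set T :=
  \bigcap_(j in [set` s]) (z j @^-1` A j).

Definition independent_family :=
  (forall j, measurable_fun setT (z j)) /\
  forall (s : seq J) (A : J -> set R), uniq s -> (forall j, measurable (A j)) ->
    P (box s A) = (\prod_(j <- s) P (z j @^-1` A j))%E.

Definition coordinate_events (K : set J) : set (set T) :=
  [set C | exists2 j, K j & exists2 A, measurable A & C = z j @^-1` A].

(** This pi-system stands in for [coordinate_events K], which generates the same events but need not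
    be closed under intersection. *)
Definition boxes (K : set J) : set (set T) :=
  [set C | exists s A, [/\ uniq s, [set` s] `<=` K,
    forall j, measurable (A j) & C = box s A]].

Lemma eq_box s A B : {in s, A =1 B} -> box s A = box s B.
Proof. by move=> AB; apply: eq_bigcapr => j js; rewrite AB. Qed.

Lemma box_cat s1 s2 A : box (s1 ++ s2) A = box s1 A `&` box s2 A.
Proof.
apply/seteqP; split=> [w sw|w [s1w s2w] j].
  by split=> j js; apply: sw; rewrite /= mem_cat js ?orbT.
by rewrite /= mem_cat => /orP[]; [exact: s1w|exact: s2w].
Qed.

Lemma box_extend s1 s2 A : (forall j, j \notin s1 -> A j = setT) ->
  {subset s1 <= s2} -> box s2 A = box s1 A.
Proof.
move=> AT s12; apply/seteqP; split=> w sw j js; first by apply: sw; exact: s12.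
by have [j1|/AT ->//] := boolP (j \in s1); exact: sw.
Qed.

Lemma box_restrict s A : box s A = box s (fun j => if j \in s then A j else setT).
Proof. by apply: eq_box => j ->. Qed.

Lemma boxT s : box s (fun=> setT) = setT.
Proof. by apply/seteqP; split. Qed.

Lemma boxes_setT K : boxes K setT.
Proof. by exists [::], (fun=> setT); split=> //; rewrite boxT. Qed.

(** Both boxes are rewritten over the union of the two index lists, with [setT] at the added
    indices, and then intersected coordinatewise. *)
Lemma boxes_setI K : setI_closed (boxes K).
Proof.
move=> _ _ [s1 [A1 [u1 k1 m1 ->]]] [s2 [A2 [u2 k2 m2 ->]]].
pose r (s : seq J) (A : J -> set R) j := if j \in s then A j else setT.
pose s := undup (s1 ++ s2).
exists s, (fun j => r s1 A1 j `&` r s2 A2 j); split.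
- exact: undup_uniq.
- by move=> j; rewrite /= mem_undup mem_cat => /orP[/k1|/k2].
- by move=> j; rewrite /r; do 2 case: ifP => _; apply: measurableI.
- rewrite box_restrict (box_restrict s2).
  have E s0 A : {subset s0 <= s} -> box s0 (r s0 A) = box s (r s0 A).
    by move=> ss; rewrite (box_extend _ ss)// => j /negbTE js; rewrite /r js.
  rewrite E; last by move=> j; rewrite mem_undup mem_cat => ->.
  rewrite E; last by move=> j; rewrite mem_undup mem_cat orbC => ->.
  by rewrite /box -bigcapI.
Qed.

Lemma coordinate_events_boxes K :
  <<s coordinate_events K >> `<=` <<s boxes K >>.
Proof.
apply: smallest_sub; first exact: smallest_sigma_algebra.
move=> C [j Kj [A mA ->]]; apply: sub_sigma_algebra; exists [:: j], (fun=> A); split=> //.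
  by move=> i; rewrite /= mem_seq1 => /eqP ->.
apply/seteqP; split=> [w Aw i|w]; first by rewrite /= mem_seq1 => /eqP ->.
by apply; rewrite /= mem_head.
Qed.

Hypothesis zI : independent_family.

Lemma measurable_box s A : (forall j, measurable (A j)) -> measurable (box s A).
Proof.
move=> mA; apply: fin_bigcap_measurable => // j _.
by rewrite -[X in measurable X]setTI; exact: zI.1.
Qed.

Lemma boxes_measurable K : boxes K `<=` measurable.
Proof. by move=> _ [s [A [_ _ mA ->]]]; exact: measurable_box. Qed.

Lemma coordinate_events_measurable K : <<s coordinate_events K >> `<=` measurable.
Proof.
apply: smallest_sub; first exact: sigma_algebra_measurable.
by move=> _ [j _ [A mA ->]]; rewrite -[X in measurable X]setTI; exact: zI.1.
Qed.

Lemma independent_boxes K L B C : K `&` L = set0 -> boxes K B -> boxes L C ->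
  P (B `&` C) = (P B * P C)%E.
Proof.
move=> KL [s1 [A1 [u1 k1 m1 ->]]] [s2 [A2 [u2 k2 m2 ->]]].
pose A j := if j \in s1 then A1 j else A2 j.
have s12 j : j \in s2 -> (j \in s1) = false.
  move=> j2; apply/negbTE/negP => j1.
  suff : (K `&` L) j by rewrite KL.
  by split; [exact: k1|exact: k2].
have E1 : {in s1, A1 =1 A} by move=> j js; rewrite /A js.
have E2 : {in s2, A2 =1 A} by move=> j js; rewrite /A s12.
rewrite (eq_box E1) (eq_box E2) -box_cat.
have mA j : measurable (A j) by rewrite /A; case: ifP.
rewrite !zI.2//; first by rewrite big_cat.
by rewrite cat_uniq u1 u2 andbT/=; apply/hasPn => j /s12 /= ->.
Qed.

(** The pi-system argument is applied twice: once to pass from boxes to events over [K], and inside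
    it once over [L]. *)
Lemma independent_coordinate_events K L B C : K `&` L = set0 ->
  <<s coordinate_events K >> B -> <<s coordinate_events L >> C ->
  P (B `&` C) = (P B * P C)%E.
Proof.
move=> KL sB sC; have mC := coordinate_events_measurable sC.
apply: (@independent_pi_system (boxes K)) => //.
- exact: boxes_measurable.
- exact: boxes_setI.
- exact: boxes_setT.
- move=> A bA; rewrite setIC muleC.
  apply: (@independent_pi_system (boxes L)) => //.
  + exact: boxes_measurable.
  + exact: boxes_setI.
  + exact: boxes_setT.
  + exact: boxes_measurable bA.
  + by move=> D bD; rewrite setIC muleC; exact: independent_boxes bA bD.
  + exact: coordinate_events_boxes.
- exact: coordinate_events_boxes.
Qed.

(* [f] is viewed on the copy of [T] carrying the sigma-algebra generated by the
   [z j], [j \in K]. *)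
Definition depends_on K (f : T -> R) :=
  measurable_fun setT (f : g_sigma_algebraType (coordinate_events K) -> R).

Lemma depends_on_coordinate K j : K j -> depends_on K (z j).
Proof.
move=> Kj _ A mA; rewrite setTI; apply: sub_sigma_algebra.
by exists j => //; exists A.
Qed.

Lemma sub_depends_on K L f : K `<=` L -> depends_on K f -> depends_on L f.
Proof.
move=> KL fK _ A mA; have sub : coordinate_events K `<=` coordinate_events L.
  by move=> C [j /KL Lj AC]; exists j.
exact: (sub_smallest2r (@smallest_sigma_algebra _ setT _) sub (fK measurableT A mA)).
Qed.

Lemma depends_on_cst K a : depends_on K (cst a).
Proof. exact: measurable_cst. Qed.

Lemma depends_onD K f g : depends_on K f -> depends_on K g ->
  depends_on K (fun w => f w + g w).
Proof. exact: measurable_funD. Qed.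

Lemma depends_onM K f g : depends_on K f -> depends_on K g ->
  depends_on K (fun w => f w * g w).
Proof. exact: measurable_funM. Qed.

Lemma depends_onX K f n : depends_on K f -> depends_on K (fun w => f w ^+ n).
Proof. by move=> fK; exact: measurable_funX. Qed.

Lemma depends_onM_mean K L f g a b : K `&` L = set0 ->
  depends_on K f -> depends_on L g -> has_mean P f a -> has_mean P g b ->
  has_mean P (fun w => f w * g w) (a * b).
Proof.
move=> KL fK gL; apply: has_meanM_independent => A B mA mB.
apply: independent_coordinate_events KL _ _.
  by have := fK measurableT A mA; rewrite setTI.
by have := gL measurableT B mB; rewrite setTI.
Qed.

End IndependentFamily.

(** * White noise *)

Section Noise.
Context {R : realType} {d : measure_display} {T : measurableType d}.
Variable P : probability T R.
Implicit Types eps eta : int -> T -> R.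

(** Merging both noises into one family turns their mutual independence into independence over
    disjoint sets of indices; [true] marks [eps]. *)
Definition noise eps eta (j : bool * int) : T -> R :=
  if j.1 then eps j.2 else eta j.2.

Lemma measurable_coordinate (t : int) (A : set R) :
  measurable A -> measurable ([set x | A (x t)] : set (pathType int R)).
Proof. by move=> mA; apply: sub_sigma_algebra; exists t, A. Qed.

(** Splitting the index list by its Boolean writes a box as an [eps]-cylinder intersected with an
    [eta]-cylinder. Independence of the processes separates the two, and each white noise factors
    its own. *)
Lemma noise_independent_family eps eta :
  strong_white_noise P eps -> strong_white_noise P eta ->
  independent_processes P eps eta -> independent_family P (noise eps eta).
Proof.
move=> [meps Ieps _] [meta Ieta _] ee; split; first by case=> -[].
move=> s A us mA.
pose s1 (b : bool) := [seq j.2 | j <- s & j.1 == b].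
pose cyl b : set (pathType int R) :=
  \bigcap_(t in [set` s1 b]) [set x | A (b, t) (x t)].
have mcyl b : measurable (cyl b).
  by apply: fin_bigcap_measurable => // t _; exact: measurable_coordinate.
have us1 b : uniq (s1 b).
  rewrite map_inj_in_uniq ?filter_uniq//.
  move=> [i1 i2] [j1 j2]; rewrite !mem_filter/= => /andP[/eqP-> _] /andP[/eqP-> _].
  by move=> ->.
have s1P b t : (t \in s1 b) = ((b, t) \in s).
  apply/mapP/idP => [[[b' t']]|bts].
    by rewrite mem_filter/= => /andP[/eqP -> ?] ->.
  by exists (b, t) => //; rewrite mem_filter eqxx.
have -> : box (noise eps eta) s A =
    trajectory eps @^-1` cyl true `&` trajectory eta @^-1` cyl false.
  apply/seteqP; split=> [w sw|w [w1 w2] [b t] /= bts].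
    by split=> t /=; rewrite s1P => /sw.
  by case: b bts => bts; [apply: w1|apply: w2]; rewrite /= s1P.
rewrite ee//.
rewrite [P (trajectory eps @^-1` _)](Ieps (s1 true) (fun t => A (true, t)))//.
rewrite [P (trajectory eta @^-1` _)](Ieta (s1 false) (fun t => A (false, t)))//.
rewrite !big_map !big_filter [RHS](bigID (fun j => j.1 == true))/=.
congr (_ * _)%E.
  by apply: eq_bigr => -[b t] /= /eqP ->.
apply: eq_big => -[b t] /=; first by case: b.
by move=> /eqP ->.
Qed.

(** For even m and n <= m, the n-th power of the absolute value is at most 1 + f^m, according to
    whether that value is below or above 1. *)
Lemma integrable_low_power (f : T -> R) (n m : nat) :
  measurable_fun setT f -> (n <= m)%N -> ~~ odd m ->
  ('E_P[fun w => (f w ^+ m)%R] < +oo)%E ->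
  P.-integrable setT (EFin \o (fun w => f w ^+ n)).
Proof.
move=> mf nm om fm.
have fm0 w : 0 <= f w ^+ m by rewrite exprn_even_ge0// om.
have mfX k : measurable_fun setT (fun w => f w ^+ k) by exact: measurable_funX.
have im : P.-integrable setT (EFin \o (fun w => f w ^+ m)).
  apply/integrableP; split; first exact/measurable_EFinP.
  move: fm; rewrite unlock; congr (_ < _)%E; apply: eq_integral => w _ /=.
  by rewrite ger0_norm.
have i1 : P.-integrable setT (EFin \o (cst 1%R : T -> R)).
  exact: finite_measure_integrable_cst.
apply: (le_integrable measurableT _ _ (integrableD measurableT i1 im)) => //.
  exact/measurable_EFinP.
move=> w _ /=; rewrite lee_fin [leRHS]ger0_norm ?addr_ge0// normrX.
have [f1|f1] := lerP `|f w| 1.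
  by rewrite (@le_trans _ _ 1) ?exprn_ile1// lerDl.
rewrite (@le_trans _ _ (f w ^+ m)) ?lerDr//.
by rewrite -[leRHS]ger0_norm// normrX ler_eXn2l.
Qed.

Lemma white_noise_mean eps (n : nat) a t : strong_white_noise P eps ->
  has_mean P (fun w => eps 0 w ^+ n) a -> has_mean P (fun w => eps t w ^+ n) a.
Proof.
move=> [meps _ deps] e0.
apply: (@has_mean_same_law _ _ _ P _ _ (eps 0) (eps t) (fun x : R => x ^+ n)) => //.
by move=> A mA; exact: deps.
Qed.

Lemma white_noise_moments eps (m : nat) : strong_white_noise P eps ->
  odd_moments_zero P (eps 0) -> ~~ odd m -> (moment P (eps 0%R) m < +oo)%E ->
  forall t n, (n <= m)%N ->
  has_mean P (fun w => eps t w ^+ n)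
    (if odd n then 0 else if n == 0 then 1 else fine (moment P (eps 0) n)).
Proof.
move=> weps oeps om em t n nm; apply: white_noise_mean => //.
have [meps _ _] := weps.
have ein := integrable_low_power (meps 0) nm om em.
have := integrable_has_mean ein.
rewrite -/(moment P (eps 0) n).
case: ifPn => [on|en].
  suff -> : moment P (eps 0) n = 0%E by [].
  have nE : n = (2 * n./2 + 1)%N by have := odd_double_half n; rewrite on -mul2n; lia.
  by rewrite nE; apply: oeps; rewrite -nE.
case: ifPn => // /eqP ->.
move=> _; apply: (eq_has_mean (has_mean_cst P 1)) => w; by rewrite expr0.
Qed.

End Noise.

(** * Moment recursions *)

Section Moments.
Context {R : realType} {d : measure_display} {T : measurableType d}.
Variables (P : probability T R) (theta alpha : R) (eps eta : int -> T -> R).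
Variables (sigma2 tau2 tau4 : R).

Let zeta := noise eps eta.
Let sig (n : nat) : R := [:: 1; 0; sigma2]`_n.
Let tau (n : nat) : R := [:: 1; 0; tau2; 0; tau4]`_n.

Hypothesis zI : independent_family P zeta.
Hypothesis eps_mean : forall t n, (n <= 2)%N ->
  has_mean P (fun w => eps t w ^+ n) (sig n).
Hypothesis eta_mean : forall t n, (n <= 4)%N ->
  has_mean P (fun w => eta t w ^+ n) (tau n).

Let U0 := U0_ tau2.
Let M := M_ theta alpha tau2 tau4.
Let N := N_ theta alpha tau2.
Let th := theta_ theta alpha eta.

Definition past (t : int) : set (bool * int) := [set j | j.2 <= t].

Notation depends_on_past t := (depends_on zeta (past t)).

Lemma depends_on_past_eps s t : s <= t -> depends_on_past t (eps s).
Proof. exact: (@depends_on_coordinate _ _ _ _ zeta (past t) (true, s)). Qed.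

Lemma depends_on_past_eta s t : s <= t -> depends_on_past t (eta s).
Proof. exact: (@depends_on_coordinate _ _ _ _ zeta (past t) (false, s)). Qed.

Lemma depends_on_past_theta t : depends_on_past t (th t).
Proof.
apply: depends_onD; last exact: depends_on_past_eta.
apply: depends_onD; first exact: depends_on_cst.
apply: depends_onM; first exact: depends_on_cst.
by apply: depends_on_past_eta; lia.
Qed.

Lemma depends_on_past_le s t f : s <= t -> depends_on_past s f -> depends_on_past t f.
Proof. by move=> st; apply: sub_depends_on => -[b r] /=; rewrite /past/=; lia. Qed.

Lemma innovation_mean t n m : (n <= 2)%N -> (m <= 4)%N ->
  has_mean P (fun w => eps t w ^+ n * eta t w ^+ m) (sig n * tau m).
Proof.
move=> n2 m4.
apply: (@depends_onM_mean _ _ _ P _ zeta zI [set (true, t)] [set (false, t)]).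
- by apply/seteqP; split=> // j [/= ->].
- by apply: depends_onX; exact: (@depends_on_coordinate _ _ _ _ zeta _ (true, t)).
- by apply: depends_onX; exact: (@depends_on_coordinate _ _ _ _ zeta _ (false, t)).
- exact: eps_mean.
- exact: eta_mean.
Qed.

Lemma past_innovation_mean t Q q n m : depends_on_past t Q -> has_mean P Q q ->
  (n <= 2)%N -> (m <= 4)%N ->
  has_mean P (fun w => Q w * (eps (t + 1) w ^+ n * eta (t + 1) w ^+ m))
    (q * (sig n * tau m)).
Proof.
move=> Qt Qq n2 m4.
apply: (@depends_onM_mean _ _ _ P _ zeta zI (past t) [set j | j.2 = t + 1]) => //.
- by apply/seteqP; split=> // -[b s] /= []; rewrite /past/=; lia.
- apply: depends_onM; apply: depends_onX.
    exact: (@depends_on_coordinate _ _ _ _ zeta _ (true, t + 1)).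
  exact: (@depends_on_coordinate _ _ _ _ zeta _ (false, t + 1)).
- exact: innovation_mean.
Qed.

(** The coefficient theta_(t+1) contains eta_t, so it is not independent of the past. Its square has
    degree two in eta_t, which is why the moments against 1, eta_t and eta_t^2 are carried along. *)
Definition has_moments (Q : T -> R) (t : int) (v : 'cV[R]_3) :=
  forall i : 'I_3, has_mean P (fun w => Q w * eta t w ^+ i) (v i 0).

Let i0 : 'I_3 := @Ordinal 3 0 isT.
Let i1 : 'I_3 := @Ordinal 3 1 isT.
Let i2 : 'I_3 := @Ordinal 3 2 isT.

Lemma eq_has_moments Q Q' t v : has_moments Q t v -> Q =1 Q' -> has_moments Q' t v.
Proof. by move=> + /funext <-. Qed.

Lemma has_momentsD Q Q' t v v' : has_moments Q t v -> has_moments Q' t v' ->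
  has_moments (fun w => Q w + Q' w) t (v + v').
Proof.
move=> Qv Qv' i; rewrite mxE; apply: (eq_has_mean (has_meanD (Qv i) (Qv' i))) => w.
by rewrite mulrDl.
Qed.

Lemma has_momentsZ Q t v k : has_moments Q t v ->
  has_moments (fun w => k * Q w) t (k *: v).
Proof.
move=> Qv i; rewrite mxE; apply: (eq_has_mean (has_meanZ k (Qv i))) => w.
by rewrite mulrA.
Qed.

Lemma has_moments_mean Q t v : has_moments Q t v -> has_mean P Q (v 0 0).
Proof.
move=> Qv; have := Qv i0; rewrite (_ : i0 = 0); last exact/val_inj.
by move=> /eq_has_mean; apply=> w; rewrite mulr1.
Qed.

Lemma mulmx3E (A : 'M[R]_3) (v : 'cV[R]_3) i :
  (A *m v) i 0 = A i i0 * v i0 0 + A i i1 * v i1 0 + A i i2 * v i2 0.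
Proof.
rewrite mxE !big_ord_recl big_ord0 addr0 addrA.
by congr (_ * _ + _ * _ + _ * _); congr (_ _ _); exact/val_inj.
Qed.

Lemma past_moments_innovation Q t v (k : 'I_3) n m :
  depends_on_past t Q -> has_moments Q t v -> (n <= 2)%N -> (m <= 4)%N ->
  has_mean P
    (fun w => Q w * eta t w ^+ k * (eps (t + 1) w ^+ n * eta (t + 1) w ^+ m))
    (v k 0 * (sig n * tau m)).
Proof.
move=> Qt Qv n2 m4; apply: past_innovation_mean => //.
by apply: depends_onM => //; apply: depends_onX; exact: depends_on_past_eta.
Qed.

Lemma has_moments_theta2 Q t v : depends_on_past t Q -> has_moments Q t v ->
  has_moments (fun w => Q w * th (t + 1) w ^+ 2) (t + 1) (M *m v).
Proof.
move=> Qt Qv i.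
have H (k : 'I_3) m : (m <= 4)%N -> _ := @past_moments_innovation Q t v k 0 m Qt Qv isT.
have i4 m : (m <= 2)%N -> (i + m <= 4)%N by have := ltn_ord i; lia.
apply: eq_has_mean.
  (* These are the six monomials of (theta + alpha eta_t + eta_(t+1))^2, weighted by eta_(t+1)^i.
     Since i goes up to 2, moments of [eta] up to order 4 occur. *)
  have -> : (M *m v) i 0 =
     theta ^+ 2 * (v i0 0 * (1 * tau (i + 0)%N)) +
     2 * theta * alpha * (v i1 0 * (1 * tau (i + 0)%N)) +
     alpha ^+ 2 * (v i2 0 * (1 * tau (i + 0)%N)) +
     2 * theta * (v i0 0 * (1 * tau (i + 1)%N)) +
     2 * alpha * (v i1 0 * (1 * tau (i + 1)%N)) +
     (v i0 0 * (1 * tau (i + 2)%N)).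
    rewrite mulmx3E !mxE; case: i {i4} => -[|[|[|//]]] ilt /=; rewrite /tau /=; ring.
  apply: has_meanD; last by apply: (H i0); exact: i4.
  apply: has_meanD; last by apply: has_meanZ; apply: (H i1); exact: i4.
  apply: has_meanD; last by apply: has_meanZ; apply: (H i0); exact: i4.
  apply: has_meanD; last by apply: has_meanZ; apply: (H i2); exact: i4.
  apply: has_meanD; last by apply: has_meanZ; apply: (H i1); exact: i4.
  by apply: has_meanZ; apply: (H i0); exact: i4.
move=> w /=; rewrite /th /theta_ addrK !exprD; ring.
Qed.

Lemma has_moments_theta Q t v : depends_on_past t Q -> has_moments Q t v ->
  has_moments (fun w => Q w * th (t + 1) w) (t + 1) (N *m v).
Proof.
move=> Qt Qv i.
have H (k : 'I_3) m : (m <= 4)%N -> _ := @past_moments_innovation Q t v k 0 m Qt Qv isT.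
have i4 m : (m <= 2)%N -> (i + m <= 4)%N by have := ltn_ord i; lia.
apply: eq_has_mean.
  have -> : (N *m v) i 0 =
     theta * (v i0 0 * (1 * tau (i + 0)%N)) +
     alpha * (v i1 0 * (1 * tau (i + 0)%N)) +
     (v i0 0 * (1 * tau (i + 1)%N)).
    rewrite mulmx3E !mxE; case: i {i4} => -[|[|[|//]]] ilt /=; rewrite /tau /=; ring.
  apply: has_meanD; last by apply: (H i0); exact: i4.
  apply: has_meanD; last by apply: has_meanZ; apply: (H i1); exact: i4.
  by apply: has_meanZ; apply: (H i0); exact: i4.
move=> w /=; rewrite /th /theta_ addrK !exprD; ring.
Qed.

Lemma has_moments_eps Q q t : depends_on_past t Q -> has_mean P Q q ->
  has_moments (fun w => Q w * eps (t + 1) w) (t + 1) 0.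
Proof.
move=> Qt Qq i; rewrite mxE.
have i4 : (i <= 4)%N by have := ltn_ord i; lia.
have := past_innovation_mean Qt Qq (isT : (1 <= 2)%N) i4.
rewrite mul0r mulr0 => /eq_has_mean; apply=> w; rewrite expr1; ring.
Qed.

(** Although theta_(t+1) and eps_(t+1) share their time, eps_(t+1) is centred and independent of
    eta_(t+1) and of the past. This kills the cross term when the recursion is squared. *)
Lemma has_moments_theta_eps Q t v : depends_on_past t Q -> has_moments Q t v ->
  has_moments (fun w => Q w * th (t + 1) w * eps (t + 1) w) (t + 1) 0.
Proof.
move=> Qt Qv i.
have H (k : 'I_3) m : (m <= 4)%N -> _ := @past_moments_innovation Q t v k 1 m Qt Qv isT.
have i4 m : (m <= 2)%N -> (i + m <= 4)%N by have := ltn_ord i; lia.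
apply: eq_has_mean.
  have -> : (0 : 'cV[R]_3) i 0 =
     theta * (v i0 0 * (0 * tau (i + 0)%N)) +
     alpha * (v i1 0 * (0 * tau (i + 0)%N)) +
     (v i0 0 * (0 * tau (i + 1)%N)).
    by rewrite mxE; ring.
  apply: has_meanD; last by apply: (H i0); exact: i4.
  apply: has_meanD; last by apply: has_meanZ; apply: (H i1); exact: i4.
  by apply: has_meanZ; apply: (H i0); exact: i4.
move=> w /=; rewrite /th /theta_ addrK !exprD; ring.
Qed.

Lemma has_moments_eps1 t : has_moments (eps t) t 0.
Proof.
move=> i; rewrite mxE; have i4 : (i <= 4)%N by have := ltn_ord i; lia.
have := innovation_mean t (isT : (1 <= 2)%N) i4.
by rewrite mul0r => /eq_has_mean; apply=> w; rewrite expr1.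
Qed.

Lemma has_moments_eps2 t : has_moments (fun w => eps t w ^+ 2) t (sigma2 *: U0).
Proof.
move=> i; rewrite mxE; have i4 : (i <= 4)%N by have := ltn_ord i; lia.
have := innovation_mean t (isT : (2 <= 2)%N) i4; congr (has_mean _ _ (_ * _)).
by rewrite mxE /tau; case: i {i4} => -[|[|[|//]]] ilt.
Qed.

Lemma has_moments1 t : has_moments (fun=> 1) t U0.
Proof.
move=> i; have i4 : (i <= 4)%N by have := ltn_ord i; lia.
rewrite (_ : U0 i 0 = tau i).
  by apply: (eq_has_mean (eta_mean t i4)) => w; rewrite mul1r.
by rewrite mxE /tau; case: i {i4} => -[|[|[|//]]] ilt.
Qed.

Definition theta_prod (t : int) (k : nat) (w : T) : R :=
  \prod_(0 <= l < k) th (t - l%:Z) w.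

Notation xterm := (Xterm theta alpha eps eta).

(** Unlike [Xpartial], this sum includes the term k = 0, which is [eps t]; it therefore satisfies
    the recursion [xsumS] exactly. *)
Definition Xsum (t : int) (n : nat) (w : T) : R := \sum_(0 <= k < n) xterm t w k.

Lemma theta_prodS t k w : theta_prod t k.+1 w = th t w * theta_prod (t - 1) k w.
Proof.
rewrite /theta_prod big_nat_recl// subr0; congr (_ * _).
by apply: eq_bigr => l _; congr (th _ w); lia.
Qed.

Lemma XtermS t w k : xterm t w k.+1 = th t w * xterm (t - 1) w k.
Proof.
rewrite /Xterm -/(theta_prod t k.+1 w) theta_prodS mulrCA -/(theta_prod _ _ _).
by congr (_ * (eps _ w * _)); lia.
Qed.

Lemma Xterm0 t w : xterm t w 0 = eps t w.
Proof. by rewrite /Xterm big_nil mulr1 subr0. Qed.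

Lemma xsumS t n w : Xsum t n.+1 w = Xsum (t - 1) n w * th t w + eps t w.
Proof.
rewrite /Xsum big_nat_recl// Xterm0 addrC; congr (_ + _).
by rewrite mulrC mulr_sumr; apply: eq_bigr => k _; rewrite XtermS.
Qed.

Lemma depends_on_past_theta_prod t k : depends_on_past t (theta_prod t k).
Proof.
elim: k t => [|k IH] t.
  rewrite (_ : theta_prod _ _ = cst 1); first exact: depends_on_cst.
  by apply/funext => w; rewrite /theta_prod big_nil.
rewrite (_ : theta_prod _ _ = fun w => th t w * theta_prod (t - 1) k w).
  apply: depends_onM; first exact: depends_on_past_theta.
  by apply: depends_on_past_le (IH (t - 1)); lia.
by apply/funext => w; exact: theta_prodS.
Qed.

Lemma depends_on_past_Xterm t k : depends_on_past t ((xterm t)^~ k).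
Proof.
apply: depends_onM; last exact: depends_on_past_theta_prod.
by apply: depends_on_past_eps; lia.
Qed.

Lemma depends_on_past_xsum t n : depends_on_past t (Xsum t n).
Proof.
elim: n t => [|n IH] t.
  rewrite (_ : Xsum _ _ = cst 0); first exact: depends_on_cst.
  by apply/funext => w; rewrite /Xsum big_nil.
rewrite (_ : Xsum _ _ = fun w => Xsum (t - 1) n w * th t w + eps t w).
  apply: depends_onD; last exact: depends_on_past_eps.
  apply: depends_onM; last exact: depends_on_past_theta.
  by apply: depends_on_past_le (IH (t - 1)); lia.
by apply/funext => w; exact: xsumS.
Qed.

(** Removing the latest coefficient leaves a product that depends on the past up to t - 1, so each
    coefficient contributes one factor [M]. The case of products without noise serves for
    uniqueness. *)
Lemma theta_prod_moments t k :
  has_moments (fun w => theta_prod t k w ^+ 2) t (M ^+ k *m U0).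
Proof.
elim: k t => [|k IH] t.
  rewrite expr0 mul1mx; apply: eq_has_moments (has_moments1 t) _ => w.
  by rewrite /theta_prod big_nil expr1n.
rewrite -{2}(subrK 1 t) exprS -mulmxA.
apply: eq_has_moments (has_moments_theta2 _ (IH (t - 1))) _.
  by apply: depends_onX; exact: depends_on_past_theta_prod.
by move=> w; rewrite theta_prodS subrK exprMn mulrC.
Qed.

Lemma Xterm_moments t k :
  has_moments (fun w => xterm t w k ^+ 2) t (sigma2 *: (M ^+ k *m U0)).
Proof.
elim: k t => [|k IH] t.
  rewrite expr0 mul1mx; apply: eq_has_moments (has_moments_eps2 t) _ => w.
  by rewrite Xterm0.
rewrite -{2}(subrK 1 t) exprS -mulmxA scalemxAr.
apply: eq_has_moments (has_moments_theta2 _ (IH (t - 1))) _.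
  by apply: depends_onX; exact: depends_on_past_Xterm.
by move=> w; rewrite [in RHS]XtermS [RHS]exprMn subrK mulrC.
Qed.

Lemma xsum_moments t n : has_moments (Xsum t n) t 0.
Proof.
elim: n t => [|n IH] t.
  rewrite -[0](scale0r U0); apply: eq_has_moments (has_momentsZ 0 (has_moments1 t)) _.
  by move=> w; rewrite /Xsum big_nil mul0r.
rewrite -[0](addr0 0) -[X in X + _](mulmx0 _ N).
apply: eq_has_moments; last by move=> w; exact/esym/xsumS.
apply: has_momentsD; last exact: has_moments_eps1.
have := has_moments_theta _ (IH (t - 1)); rewrite subrK; apply.
exact: depends_on_past_xsum.
Qed.

Definition xsum_sq_moments (n : nat) : 'cV[R]_3 :=
  iter n (fun v => M *m v + sigma2 *: U0) 0.

Lemma xsum_sq_momentsP t n :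
  has_moments (fun w => Xsum t n w ^+ 2) t (xsum_sq_moments n).
Proof.
elim: n t => [|n IH] t /=.
  rewrite -[0](scale0r U0); apply: eq_has_moments (has_momentsZ 0 (has_moments1 t)) _.
  by move=> w; rewrite /Xsum big_nil mul0r expr0n.
have dn := @depends_on_past_xsum (t - 1) n.
have H2 := has_moments_theta2 (depends_onX 2 dn) (IH (t - 1)).
have H1 := has_momentsZ 2 (has_moments_theta_eps dn (xsum_moments (t - 1) n)).
rewrite subrK scaler0 in H1 H2.
have := has_momentsD (has_momentsD H2 H1) (has_moments_eps2 t).
rewrite addr0 => /eq_has_moments; apply=> w.
by rewrite xsumS; ring.
Qed.

(** The truncation level grows with the lag, so that h steps of the recursion lead from
    [Xsum (t + h) (n + h)] back to [Xsum t n] exactly. Each step contributes [N], and its centred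
    noise term drops out. *)
Lemma xsum_cross_moments t n h :
  has_moments (fun w => Xsum t n w * Xsum (t + h%:Z) (n + h) w) (t + h%:Z)
    (N ^+ h *m xsum_sq_moments n).
Proof.
elim: h => [|h IH].
  rewrite addr0 addn0 expr0 mul1mx; apply: eq_has_moments (xsum_sq_momentsP t n) _.
  by move=> w; rewrite expr2.
have dn : depends_on_past (t + h%:Z) (Xsum t n).
  by apply: depends_on_past_le (@depends_on_past_xsum t n); lia.
have dnh := depends_onM dn (@depends_on_past_xsum (t + h%:Z) (n + h)).
have H1 := has_moments_theta dnh IH.
have H2 := has_moments_eps dn (has_moments_mean (xsum_moments t n)).
have tE : t + h.+1%:Z = t + h%:Z + 1 by lia.
rewrite addnS tE exprS -mulmxA.
have := has_momentsD H1 H2; rewrite addr0 => /eq_has_moments; apply=> w.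
by rewrite xsumS addrK; ring.
Qed.

End Moments.

(** * Sequences and limits *)

Section RealSequences.
Context {R : realType}.

Lemma geometric_sum_le (x : R) n : 0 <= x < 1 ->
  \sum_(0 <= k < n) x ^+ k <= (1 - x)^-1.
Proof.
move=> /andP[x0 x1]; have x1' : 1 - x != 0 by rewrite subr_eq0 gt_eqF.
have -> : \sum_(0 <= k < n) x ^+ k = (1 - x ^+ n) / (1 - x).
  elim: n => [|n IH]; first by rewrite big_nil expr0 subrr mul0r.
  rewrite big_nat_recr//= IH exprS; field.
  exact: x1'.
by rewrite ler_pdivrMr ?subr_gt0// mulVf// gerBl exprn_ge0.
Qed.

Lemma weighted_square_summable (x : nat -> R) (q D : R) : 0 < q < 1 ->
  (forall n, \sum_(0 <= k < n) x k ^+ 2 / q ^+ k <= D) ->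
  cvgn (series x) /\ forall n, series x n ^+ 2 <= (1 - q)^-1 * D.
Proof.
move=> /andP[q0 q1] xD.
have K0 : 0 < (1 - q)^-1 by rewrite invr_gt0 subr_gt0.
have D0 : 0 <= D by have := xD 0%N; rewrite big_nil.
have absD n : (\sum_(0 <= k < n) `|x k|) ^+ 2 <= (1 - q)^-1 * D.
  set S := \sum_(0 <= k < n) _; set K := (1 - q)^-1.
  have Kn : \sum_(0 <= k < n) q ^+ k <= K.
    by apply: geometric_sum_le; rewrite (ltW q0).
  (* Cauchy-Schwarz by completing the square: this s minimises D - 2 s S + s^2 K, whose minimum is D
     - S^2 / K. *)
  pose s := S / K.
  have : 0 <= \sum_(0 <= k < n)
      (x k ^+ 2 / q ^+ k - 2 * s * `|x k| + s ^+ 2 * q ^+ k).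
    apply: sumr_ge0 => k _.
    have qk : 0 < q ^+ k by rewrite exprn_gt0.
    have -> : x k ^+ 2 / q ^+ k - 2 * s * `|x k| + s ^+ 2 * q ^+ k =
      (`|x k| - s * q ^+ k) ^+ 2 / q ^+ k.
      rewrite -(real_normK (num_real (x k))); field; exact: lt0r_neq0.
    by rewrite divr_ge0 ?sqr_ge0 ?ltW.
  rewrite big_split sumrB/= -!mulr_sumr -/S => H.
  have {H} : 0 <= D - 2 * s * S + s ^+ 2 * K.
    have := xD n; have := ler_wpM2l (sqr_ge0 s) Kn; lra.
  have -> : D - 2 * s * S + s ^+ 2 * K = D - S ^+ 2 / K.
    by rewrite /s; field; exact: lt0r_neq0.
  by rewrite subr_ge0 ler_pdivrMr// mulrC.
split; last first.
  move=> n; apply: le_trans (absD n).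
  rewrite -[leLHS]real_normK ?num_real// lerXn2r ?nnegrE//.
    by rewrite sumr_ge0.
  exact: ler_norm_sum.
apply: normed_cvg; apply: nondecreasing_is_cvgn.
  by apply: nondecreasing_series => k _ _; exact: normr_ge0.
exists (1 + (1 - q)^-1 * D) => _ [n _ <-] /=.
have S1 (S : R) : S <= 1 + S ^+ 2 by nra.
by apply: le_trans (S1 _) _; rewrite lerD2l; exact: absD.
Qed.

Lemma mulmx_geometric m n (A : 'M[R]_n.+1) (B : 'M[R]_(m, n.+1)) (u : 'cV[R]_n.+1) i :
  spectral_radius A < 1 ->
  exists C rho : R, [/\ 0 < C, 0 < rho < 1 &
    forall k, `|(B *m (A ^+ k *m u)) i 0| <= C * rho ^+ k].
Proof.
move=> /spectral_radius_lt1_geometric[C [rho [C0 rho01 Arho]]].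
exists (1 + \sum_j \sum_l `|B i j| * C * `|u l 0|), rho; split=> // [|k].
  rewrite ltr_wpDr// sumr_ge0// => j _; rewrite sumr_ge0// => l _.
  by rewrite !mulr_ge0// ltW.
have rk : 0 <= rho ^+ k by rewrite exprn_ge0//; case/andP: rho01 => /ltW.
rewrite mulrDl (@le_trans _ _ ((\sum_j \sum_l `|B i j| * C * `|u l 0|) * rho ^+ k))//.
  rewrite mxE mulr_suml (le_trans (ler_norm_sum _ _ _))// ler_sum// => j _.
  rewrite mxE normrM mulr_suml.
  rewrite (le_trans (ler_wpM2l (normr_ge0 _) (ler_norm_sum _ _ _)))//.
  rewrite mulr_sumr ler_sum// => l _.
  rewrite normrM -!mulrA ler_wpM2l//.
  rewrite (le_trans (ler_wpM2r (normr_ge0 _) (Arho k j l)))//.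
  by rewrite -mulrA [rho ^+ k * _]mulrC.
by rewrite lerDr mul1r.
Qed.

Lemma geometric_cvg0 (C rho : R) (u : nat -> R) : 0 < rho < 1 ->
  (forall k, `|u k| <= C * rho ^+ k) -> u @ \oo --> 0.
Proof.
move=> /andP[r0 r1] uC; apply/norm_cvg0P.
apply: (@squeeze_cvgr _ _ _ _ (cst 0) (fun k => C * rho ^+ k)).
- by apply: nearW => k; rewrite normr_ge0 uC.
- exact: cvg_cst.
- rewrite -(mulr0 C); apply: cvgMr; apply: cvg_expr.
  by rewrite ger0_norm ?ltW.
Qed.

End RealSequences.

Section MeasurableLimit.
Context {R : realType} {d : measure_display} {T : measurableType d}.
Variable h : nat -> T -> R.
Hypothesis mh : forall n, measurable_fun setT (h n).

(** Completeness replaces convergence by the Cauchy condition with tolerances 1/(k+1), which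
    involves only countable unions and intersections. *)
Lemma measurable_cvgn_set : measurable [set x | cvgn (h ^~ x)].
Proof.
have -> : [set x | cvgn (h ^~ x)] =
    \bigcap_k \bigcup_N \bigcap_(n in [set n | (N <= n)%N])
      ((fun x => `|h N x - h n x|) @^-1` [set y | y < k.+1%:R^-1]).
  apply/seteqP; split=> x /= hx.
    move=> k _; have e0 : (0 : R) < k.+1%:R^-1 / 2 by rewrite divr_gt0// invr_gt0.
    have /cvgrPdist_lt/(_ _ e0)[N _ hN] := hx.
    exists N => // n /= Nn.
    have := hN N (leqnn N); have := hN n Nn; rewrite /= distrC.
    set l := limn _ => a b.
    rewrite -(subrK l (h N x)) -addrA (le_lt_trans (ler_normD _ _))//.
    by rewrite distrC in b; rewrite distrC in a; rewrite [_^-1]splitr ltrD// distrC.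
  apply/cauchy_cvgP/cauchy_exP => e e0.
  have [k ke] : exists k : nat, k.+1%:R^-1 < e.
    have e1 : 0 <= e^-1 by rewrite invr_ge0 ltW.
    have H := archi_boundP e1.
    exists (Num.bound e^-1); rewrite invf_plt ?posrE//.
    by rewrite (lt_trans H)// ltr_nat.
  have [N _ hN] := hx k Logic.I.
  exists (h N x); exists N => // n /= Nn; rewrite /ball/=.
  by apply: lt_trans ke; exact: hN.
apply: bigcapT_measurable => k; apply: bigcupT_measurable => N.
apply: bigcap_measurable => [|n /= Nn]; first by exists N => /=.
have mhNn : measurable_fun setT (fun x => `|h N x - h n x|).
  by apply: measurableT_comp => //; exact: measurable_funB.
have mk : measurable [set y : R | y < k.+1%:R^-1].
  rewrite (_ : mkset _ = [set` `]-oo, k.+1%:R^-1[ ])//.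
by rewrite -[X in measurable X]setTI; exact: mhNn measurableT _ mk.
Qed.

(* On the divergence set [limn] is the constant [point]. *)
Lemma measurable_limn : measurable_fun setT (fun x => limn (h ^~ x)).
Proof.
rewrite -(setUv [set x | cvgn (h ^~ x)]).
apply/measurable_funU; [exact: measurable_cvgn_set| |split].
  exact/measurableC/measurable_cvgn_set.
  apply: (@measurable_fun_cvg _ _ _ _ h) => [m|x]; last by [].
  exact: measurable_funS (mh m).
apply: (@eq_measurable_fun _ _ _ _ _ (cst point)); last exact: measurable_cst.
move=> x; rewrite inE => /= hx; apply/esym/dvgP.
by apply: contra_not hx.
Qed.

End MeasurableLimit.

(** * Mixing *)

Section Mixing.
Context {R : realType} {d : measure_display} {T : measurableType d}.
Variable m : probability T R.

Let pr (A : set T) : R := fine (m A).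

Let prE A : measurable A -> (pr A)%:E = m A.
Proof. by move=> mA; rewrite fineK ?fin_num_measure. Qed.

Let pr_setU A B : measurable A -> measurable B -> A `&` B = set0 ->
  pr (A `|` B) = pr A + pr B.
Proof.
move=> mA mB AB.
by rewrite /pr measureU// fineD ?fin_num_measure.
Qed.

Let le_pr A B : measurable A -> measurable B -> A `<=` B -> pr A <= pr B.
Proof.
move=> mA mB AB; rewrite fine_le ?fin_num_measure//.
by rewrite le_measure ?inE.
Qed.

Let pr_setIC A B : measurable A -> measurable B ->
  pr (A `&` ~` B) = pr A - pr (A `&` B).
Proof.
move=> mA mB; rewrite -setDE; apply/eqP; rewrite eq_sym subr_eq; apply/eqP.
rewrite -pr_setU; [|exact: measurableD|exact: measurableI|].
  by rewrite setUC setUIDK.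
by apply/seteqP; split=> // x [[_ Bx] [_ /Bx]].
Qed.

(** The sets with this limit form a Dynkin system. For a countable disjoint union, finite partial
    unions are handled by additivity, and the tail is negligible uniformly in n. *)
Lemma mixing_pi_system (G : set (set T)) (X : nat -> set T) (b : R) :
  @measurable _ T = <<s G >> -> setI_closed G -> G setT ->
  (forall n, measurable (X n)) ->
  (forall A, G A -> pr (X n `&` A) @[n --> \oo] --> b * pr A) ->
  forall A, measurable A -> pr (X n `&` A) @[n --> \oo] --> b * pr A.
Proof.
move=> GE GI GT mX GX A; rewrite GE; move: A.
apply: dynkin_induction => //; first exact: GX.
  move=> A mA XA.
  have -> : b * pr (~` A) = b * pr setT - b * pr A.
    by rewrite -mulrBr -[~` A]setTI pr_setIC// setTI.
  rewrite (_ : (fun n => _) = fun n => pr (X n `&` setT) - pr (X n `&` A)).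
    by apply: cvgB => //; exact: GX.
  by apply/funext => n; rewrite pr_setIC// setIT.
move=> F mF tF XF; set C := \bigcup_k F k.
have mC : measurable C by exact: bigcupT_measurable.
pose H K := \big[setU/set0]_(k < K) F k.
have mH K : measurable (H K) by exact: bigsetU_measurable.
have HC K : H K `<=` C.
  by rewrite /H -bigcup_mkord => x [k _ Fx]; exists k.
have HS K : H K.+1 = H K `|` F K by rewrite /H big_ord_recr.
have HF K : H K `&` F K = set0.
  apply/seteqP; split=> // x []; rewrite /H -bigcup_mkord => -[k kK Fkx] FKx.
  have : k = K by apply: (tF k K) => //; exists x.
  by move=> kE; move: kK; rewrite /= kE ltnn.
have HX K : pr (X n `&` H K) @[n --> \oo] --> b * pr (H K).
  elim: K => [|K IH].
    rewrite {2}/H big_ord0 (_ : (fun n => _) = cst 0).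
      by rewrite /pr measure0/= mulr0; exact: cvg_cst.
    by apply/funext => n; rewrite /H big_ord0 setI0 /pr measure0.
  rewrite HS pr_setU// mulrDr.
  rewrite (_ : (fun n => _) = fun n => pr (X n `&` H K) + pr (X n `&` F K)).
    exact: cvgD.
  apply/funext => n; rewrite setIUr pr_setU//; try exact: measurableI.
  by rewrite setIACA HF setI0.
have HCcvg : pr (H K) @[K --> \oo] --> pr C.
  have /fine_cvg : (\sum_(0 <= k < K) m (F k))%E @[K --> \oo] --> (pr C)%:E.
    by rewrite prE//; exact: measure_semi_sigma_additive.
  apply: cvg_trans; apply: near_eq_cvg; apply: nearW => K /=.
  by rewrite /pr /H measure_bigsetU// big_mkord.
apply/cvgrPdist_le => e e0.
(* Three errors are added below, with weights the absolute value of [b], 1 and 1. *)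
pose e' := e / (2 + `|b|).
have e'0 : 0 < e' by rewrite divr_gt0// ltr_wpDr.
have /cvgrPdist_le/(_ _ e'0)[K _ /(_ K (leqnn K))/= HK] := HCcvg.
have /cvgrPdist_le/(_ _ e'0)[N _ HN] := HX K.
exists N => // n /HN/= {}HN.
(* The part of [X n] in the tail has at most the mass of the tail, whatever n is. *)
have XC : `|pr (X n `&` C) - pr (X n `&` H K)| <= e'.
  apply: le_trans HK.
  have mCH : measurable (C `&` ~` H K) by apply: measurableI => //; exact: measurableC.
  have hc : C `&` H K = H K by apply/setIidPr; exact: HC.
  rewrite -{2}hc -pr_setIC// [leRHS]ger0_norm ?fine_ge0//.
  have -> : X n `&` H K = (X n `&` C) `&` H K by rewrite -setIA hc.
  rewrite -pr_setIC//; last exact: measurableI.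
  rewrite ger0_norm ?fine_ge0//; apply: le_pr => //.
    by apply: measurableI; [exact: measurableI|exact: measurableC].
  by move=> x [[_ ?] ?].
have -> : b * pr C - pr (X n `&` C) = b * (pr C - pr (H K)) +
  (b * pr (H K) - pr (X n `&` H K)) - (pr (X n `&` C) - pr (X n `&` H K)) by ring.
rewrite (le_trans (ler_normB _ _))//.
apply: (le_trans (lerD (ler_normD _ _) (lexx _))); rewrite normrM.
have -> : e = `|b| * e' + e' + e'.
  by rewrite /e'; field; rewrite gt_eqF// ltr_wpDr.
by rewrite !lerD// ler_wpM2l.
Qed.

(** For invariant [D], the mass of the n-th preimage of [B] intersected with [D] does not depend on
    n, while mixing sends it to the product of the masses. So [D] is independent of each [B] in [G],
    hence of itself, and its mass equals its own square. *)
Lemma mixing_zero_one (G : set (set T)) (S : T -> T) (D : set T) :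
  @measurable _ T = <<s G >> -> setI_closed G -> G setT ->
  measurable_fun setT S ->
  (forall A, measurable A -> m (S @^-1` A) = m A) ->
  (forall A B, G A -> G B ->
    pr (iter n S @^-1` B `&` A) @[n --> \oo] --> pr B * pr A) ->
  measurable D -> S @^-1` D = D -> m D = 0%E \/ m D = 1%E.
Proof.
move=> GE GI GT mS pS mix mD SD.
have Gm : G `<=` measurable by rewrite GE; exact: sub_sigma_algebra.
have mSn n A : measurable A -> measurable (iter n S @^-1` A).
  move=> mA; elim: n => [//|n IH].
  have -> : iter n.+1 S @^-1` A = S @^-1` (iter n S @^-1` A).
    by apply/seteqP; split=> x; rewrite /preimage/= -iterSr.
  by rewrite -[X in measurable X]setTI; exact: mS.
have BD B : G B -> m (B `&` D) = (m B * m D)%E.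
  move=> GB; have mB := Gm _ GB.
  have := mixing_pi_system GE GI GT (fun n => mSn n B mB) (fun A GA => mix A B GA GB) mD.
  have -> : (fun n => pr (iter n S @^-1` B `&` D)) = cst (pr (B `&` D)).
    apply/funext => n; rewrite /cst; elim: n => [//|n <-].
    rewrite /pr -[in RHS]pS; last first.
      by apply: measurableI => //; exact: mSn.
    congr (fine (m _)); rewrite preimage_setI SD; congr (_ `&` _).
    by apply/seteqP; split=> x; rewrite /preimage/= -iterSr.
  move=> /(cvg_unique (@Rhausdorff R))/(_ (cvg_cst _)) H.
  by rewrite -!prE//; [rewrite -EFinM H|exact: measurableI].
have := @independent_pi_system _ _ _ m G D Gm GI GT mD BD D.
rewrite -GE setIid => /(_ mD); rewrite -prE// -EFinM => -[] H.
have : pr D * (1 - pr D) = 0 by rewrite mulrBr mulr1 -H subrr.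
by move=> /eqP; rewrite mulf_eq0 subr_eq0 => /orP[|] /eqP; [left|right]; congr EFin.
Qed.

End Mixing.

(** * Path spaces and the shift of the noise law *)

Lemma measurable_path d (T : measurableType d) (I : Type) d' (S : measurableType d')
    (f : T -> pathType I S) :
  (forall i, measurable_fun setT (fun x => f x i)) -> measurable_fun setT f.
Proof.
move=> mf; apply: (@measurability _ _ T (pathType I S) setT f (@cylinder I d' S) erefl).
by move=> _ [_ [i [A mA ->]] <-]; exact: mf.
Qed.

Lemma measurable_eval (I : Type) d (S : measurableType d) (i : I) :
  measurable_fun setT (fun x : pathType I S => x i).
Proof.
by move=> _ A mA; rewrite setTI; apply: sub_sigma_algebra; exists i, A.
Qed.

Section PathLaw.
Context {R : realType} {d : measure_display} {T : measurableType d}.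
Variable P : probability T R.
Context {J : eqType}.

Definition coord (j : J) (x : pathType J R) : R := x j.

Section Family.
Variable z : J -> T -> R.
Hypothesis zI : independent_family P z.

Definition path_of (w : T) : pathType J R := fun j => z j w.

Lemma measurable_path_of : measurable_fun setT path_of.
Proof. by apply: measurable_path => j; exact: zI.1. Qed.

HB.instance Definition _ := isMeasurableFun.Build _ _ _ _ path_of measurable_path_of.

(** No shift is given on the original probability space. On the path space it is an actual map, and
    the noise becomes the coordinate family. *)
Definition path_law : probability (pathType J R) R := distribution P path_of.

Lemma coord_independent_family : independent_family path_law coord.
Proof. by split=> [j|s A us mA]; [exact: measurable_eval|exact: zI.2]. Qed.

End Family.

Lemma measurable_pathE (z : J -> T -> R) : independent_family P z ->
  @measurable _ (pathType J R) = <<s boxes coord setT >>.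
Proof.
move=> zI; apply/seteqP; split; last first.
  apply: smallest_sub; first exact: sigma_algebra_measurable.
  exact: (boxes_measurable (coord_independent_family zI)).
apply: smallest_sub; first exact: smallest_sigma_algebra.
move=> _ [j [A mA ->]]; apply: coordinate_events_boxes.
by apply: sub_sigma_algebra; exists j => //; exists A.
Qed.

End PathLaw.

Section NoiseLaw.
Context {R : realType} {d : measure_display} {T : measurableType d}.
Variables (P : probability T R) (z : bool * int -> T -> R).
Hypothesis zI : independent_family P z.
Hypothesis z_id : forall b s t A, measurable A ->
  P (z (b, s) @^-1` A) = P (z (b, t) @^-1` A).

Let m := path_law zI.

Definition noise_shift (h : int) (x : pathType (bool * int) R) :
  pathType (bool * int) R := fun j => x (j.1, j.2 + h).

Lemma measurable_noise_shift h : measurable_fun setT (noise_shift h).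
Proof. by apply: measurable_path => j; exact: measurable_eval. Qed.

Lemma iter_noise_shift n : iter n (noise_shift 1) = noise_shift n%:Z.
Proof.
apply/funext => x; elim: n => [|n IH].
  by apply/funext => -[b t]; rewrite /noise_shift addr0.
rewrite iterS IH; apply/funext => -[b t]; rewrite /noise_shift/=.
by congr (x (_, _)); lia.
Qed.

Let shift_idx (h : int) (j : bool * int) := (j.1, j.2 + h).

Let shift_idxK h : cancel (shift_idx h) (shift_idx (- h)).
Proof. by case=> b t; rewrite /shift_idx/= addrK. Qed.

Lemma noise_shift_box h s (A : bool * int -> set R) :
  noise_shift h @^-1` box coord s A =
  box coord [seq shift_idx h j | j <- s] (A \o shift_idx (- h)).
Proof.
apply/seteqP; split=> x sx j /=.
  by move=> /mapP[i si ->] /=; rewrite shift_idxK; exact: sx.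
move=> sj; have /= := sx (shift_idx h j); rewrite shift_idxK; apply.
exact: map_f.
Qed.

(** The law and its image under the shift agree on boxes, by independence and identical distribution
    in time, and boxes generate the sigma-algebra. *)
Lemma noise_law_shift h C : measurable C -> m (noise_shift h @^-1` C) = m C.
Proof.
have mI := coord_independent_family zI.
have mS := measurable_noise_shift h.
pose S : {mfun pathType (bool * int) R >-> pathType (bool * int) R} :=
  HB.pack (noise_shift h) (isMeasurableFun.Build _ _ _ _ _ mS).
rewrite {1}(measurable_pathE zI) -[m (_ @^-1` _)]/(distribution m S C).
apply: (@measure_eq_pi_system _ _ _ (distribution m S) m (boxes coord setT)).
- exact: (boxes_measurable mI).
- exact: boxes_setI.
- exact: boxes_setT.
- by rewrite (@le_lt_trans _ _ 1%E) ?ltry// probability_le1.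
move=> _ [s [A [us _ mA ->]]].
rewrite -[LHS]/(m (noise_shift h @^-1` _)) noise_shift_box.
have us' : uniq [seq shift_idx h j | j <- s].
  by rewrite map_inj_uniq//; exact: can_inj (shift_idxK h).
rewrite [RHS](mI.2 s A us mA) [LHS](mI.2 _ _ us'); last by move=> j; exact: mA.
rewrite big_map; apply: eq_bigr => -[b t] _ /=.
rewrite (_ : shift_idx _ (shift_idx _ _) = (b, t)); last exact: shift_idxK.
exact: z_id.
Qed.

Lemma noise_law_zero_one D : measurable D -> noise_shift 1 @^-1` D = D ->
  m D = 0%E \/ m D = 1%E.
Proof.
have mI := coord_independent_family zI.
apply: (@mixing_zero_one _ _ _ m (boxes coord setT)).
- exact: measurable_pathE zI.
- exact: boxes_setI.
- exact: boxes_setT.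
- exact: measurable_noise_shift.
- exact: noise_law_shift.
move=> A B bA bB.
have mA := boxes_measurable mI bA; have mB := boxes_measurable mI bB.
have bound (s : seq (bool * int)) : exists N : nat, {in s, forall j, (`|j.2| <= N)%N}.
  elim: s => [|i s [N IH]]; first by exists 0%N.
  exists (maxn N `|i.2|) => j; rewrite in_cons leq_max => /orP[/eqP ->|/IH ->//].
  by rewrite leqnn orbT.
apply: (@cvg_trans _ (nbhs (cst (fine (m B) * fine (m A)) @ \oo))); last exact: cvg_cst.
apply: near_eq_cvg.
case: bA bB mA mB => s1 [A1 [u1 _ m1 ->]] [s2 [A2 [u2 _ m2 ->]]] mA mB.
have [N1 hN1] := bound s1; have [N2 hN2] := bound s2.
(* The indices of the two boxes have times bounded by N1 and N2 in absolute value. A shift by more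
   than N1 + N2 makes them disjoint, so the mixing sequence is eventually constant. *)
exists (N1 + N2).+1 => // n /= Nn.
rewrite -fineM ?fin_num_measure// iter_noise_shift; congr fine.
rewrite -(noise_law_shift n%:Z mB) noise_shift_box; apply/esym.
set s := [seq _ | _ <- s2].
apply: (independent_boxes mI (_ : [set` s] `&` [set` s1] = set0)).
- apply/seteqP; split=> // j [/= /mapP[i i2 ->] j1].
  by have := hN1 _ j1; have := hN2 _ i2; rewrite /shift_idx/=; lia.
- exists s, (A2 \o shift_idx (- n%:Z)); split=> //.
    by rewrite map_inj_uniq//; exact: can_inj (shift_idxK n).
  by move=> j; exact: m2.
- by exists s1, A1; split.
Qed.

End NoiseLaw.

(** * The causal series *)

Section MeasurableModel.
Context {R : realType} {d : measure_display} {T : measurableType d}.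
Variables (theta alpha : R) (eps eta : int -> T -> R).
Hypothesis meps : forall t, measurable_fun setT (eps t).
Hypothesis meta : forall t, measurable_fun setT (eta t).

Lemma measurable_theta t : measurable_fun setT (theta_ theta alpha eta t).
Proof.
apply: measurable_funD => //; apply: measurable_funD; first exact: measurable_cst.
by apply: measurable_funM => //; exact: measurable_cst.
Qed.

Lemma measurable_Xterm t k : measurable_fun setT ((Xterm theta alpha eps eta t)^~ k).
Proof.
apply: measurable_funM => //; apply: measurable_prod => l _.
exact: measurable_theta.
Qed.

Lemma measurable_X t : measurable_fun setT (X_ theta alpha eps eta t).
Proof.
apply: measurable_funD => //; apply: measurable_limn => n.
by apply: measurable_sum => k; exact: measurable_Xterm.
Qed.

End MeasurableModel.

Section CausalRepresentation.
Context {R : realType}.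
Variables (theta alpha : R).

Notation innovation := (pathType nat (R * R)%type).

(** The series is evaluated at time 0 on the space of one-sided innovation paths. Only times t <= 0
    occur there, and their absolute value is the lag. *)
Definition X_functional (x : innovation) : R :=
  X_ theta alpha (fun t (y : innovation) => (y `|t|%N).1)
    (fun t (y : innovation) => (y `|t|%N).2) 0 x.

Lemma X_functionalE d (T : measurableType d) (eps eta : int -> T -> R) t w :
  X_ theta alpha eps eta t w =
  X_functional (fun k => (eps (t - k%:Z) w, eta (t - k%:Z) w)).
Proof.
have ix k : t - `|(0 - k%:Z)%R|%N%:Z = t - k%:Z by lia.
have ix1 k : t - `|(0 - k%:Z - 1)%R|%N%:Z = t - k%:Z - 1 by lia.
rewrite /X_functional /X_ /= subr0; congr (_ + limn _).
apply/funext => n; rewrite /Xpartial; apply: eq_bigr => k _.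
rewrite /Xterm /= ix; congr (_ * _); apply: eq_bigr => l _.
by rewrite /theta_/= ix ix1.
Qed.

Lemma measurable_X_functional : measurable_fun setT X_functional.
Proof.
have me k : measurable_fun setT (fun x : innovation => x k) by exact: measurable_eval.
by apply: measurable_X => t; [apply: measurableT_comp measurable_fst _|
  apply: measurableT_comp measurable_snd _].
Qed.

End CausalRepresentation.

Section StationaryErgodic.
Context {R : realType} {d : measure_display} {T : measurableType d}.
Variables (P : probability T R) (theta alpha : R) (eps eta : int -> T -> R).
Hypothesis eps_noise : strong_white_noise P eps.
Hypothesis eta_noise : strong_white_noise P eta.
Hypothesis eps_eta_indep : independent_processes P eps eta.

Notation X := (X_ theta alpha eps eta).

Let zI := noise_independent_family eps_noise eta_noise eps_eta_indep.

Let z_id b s t A : measurable A ->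
  P (noise eps eta (b, s) @^-1` A) = P (noise eps eta (b, t) @^-1` A).
Proof.
have [_ _ ideps] := eps_noise; have [_ _ ideta] := eta_noise.
by move=> mA; case: b; [exact: ideps|exact: ideta].
Qed.

(** The whole trajectory is a measurable function of the noise path that commutes with the shifts;
    invariance and the zero-one law of the noise are thus inherited by [X]. *)
Let X_path (x : pathType (bool * int) R) : pathType int R := fun t =>
  X_ theta alpha (fun t (y : pathType (bool * int) R) => y (true, t))
    (fun t (y : pathType (bool * int) R) => y (false, t)) t x.

Let measurable_X_path : measurable_fun setT X_path.
Proof.
by apply: measurable_path => t; apply: measurable_X => s; exact: measurable_eval.
Qed.

Let X_path_shift h x : X_path (noise_shift h x) = path_shift h (X_path x).
Proof.
apply/funext => t; rewrite /path_shift/= /X_path !X_functionalE.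
by congr (X_functional _ _ _); apply/funext => k; rewrite /noise_shift/= addrAC.
Qed.

Let trajectoryE C : P (trajectory X @^-1` C) = path_law zI (X_path @^-1` C).
Proof. by []. Qed.

Lemma X_strictly_stationary : strictly_stationary P X.
Proof.
have [meps _ _] := eps_noise; have [meta _ _] := eta_noise.
split=> [t|h C mC]; first exact: measurable_X.
rewrite !trajectoryE -[RHS](noise_law_shift zI z_id h).
  by congr (path_law zI _); apply/seteqP; split=> x; rewrite /preimage/= X_path_shift.
by rewrite -[X in measurable X]setTI; exact: measurable_X_path.
Qed.

Lemma X_ergodic : ergodic P X.
Proof.
move=> C mC SC; rewrite trajectoryE; apply: (noise_law_zero_one zI z_id).
  by rewrite -[X in measurable X]setTI; exact: measurable_X_path.
by rewrite -[in RHS]SC; apply/seteqP; split=> x; rewrite /preimage/= X_path_shift.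
Qed.

Lemma X_causal : causal P eps eta X.
Proof.
exists (X_functional theta alpha); first exact: measurable_X_functional.
by move=> t; apply: aeW => w; exact: X_functionalE.
Qed.

End StationaryErgodic.

(** * Convergence in mean square *)

Section MeanLimits.
Context {R : realType} {d : measure_display} {T : measurableType d}.
Variable P : probability T R.

Lemma has_mean_ge0 (f : T -> R) a : (forall w, 0 <= f w) -> has_mean P f a -> 0 <= a.
Proof.
move=> f0 [_ fa]; rewrite -lee_fin -fa; apply: integral_ge0 => w _.
by rewrite lee_fin.
Qed.

(** The dominating function is extended-valued because it will be built from [envelope], which may
    be infinite on a null set. *)
Lemma has_mean_dominated_cvg (f_ : nat -> T -> R) (f : T -> R) (g : T -> \bar R)
    (a_ : nat -> R) a :
  measurable_fun setT f -> (forall n, has_mean P (f_ n) (a_ n)) ->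
  P.-integrable setT g ->
  {ae P, forall w, f_ ^~ w @ \oo --> f w} ->
  {ae P, forall w, forall n, (`|f_ n w|%:E <= g w)%E} ->
  a_ @ \oo --> a -> has_mean P f a.
Proof.
move=> mf fa gi ff fg aa.
have mf_ n : measurable_fun setT (EFin \o f_ n).
  exact/measurable_EFinP/(has_mean_measurable (fa n)).
have mEf : measurable_fun setT (EFin \o f) by exact/measurable_EFinP.
have ffE : {ae P, forall w, setT w -> (EFin \o f_ n) w @[n --> \oo] --> (EFin \o f) w}.
  by apply: filterS ff => w ? _; apply: cvg_EFin => //; exact: nearW.
have fgE : {ae P, forall w n, setT w -> (`|(EFin \o f_ n) w| <= g w)%E}.
  by apply: filterS fg => w H n _; exact: H.
have [fi _ fl] := dominated_convergence measurableT mf_ mEf ffE gi fgE.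
split=> //; apply: (cvg_unique _ fl) => //.
rewrite (_ : [sequence _]_n = EFin \o a_); last first.
  by apply/funext => n; rewrite /= (fa n).2.
apply: cvg_EFin => //; exact: nearW.
Qed.

End MeanLimits.

Section SquareIntegrableLimit.
Context {R : realType} {d : measure_display} {T : measurableType d}.
Variables (P : probability T R) (theta alpha : R) (eps eta : int -> T -> R).
Variables (sigma2 tau2 tau4 : R).

Let sig (n : nat) : R := [:: 1; 0; sigma2]`_n.
Let tau (n : nat) : R := [:: 1; 0; tau2; 0; tau4]`_n.

Hypothesis zI : independent_family P (noise eps eta).
Hypothesis eps_mean : forall t n, (n <= 2)%N ->
  has_mean P (fun w => eps t w ^+ n) (sig n).
Hypothesis eta_mean : forall t n, (n <= 4)%N ->
  has_mean P (fun w => eta t w ^+ n) (tau n).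
Hypothesis sigma2_gt0 : 0 < sigma2.

Let U0 := U0_ tau2.
Let M := M_ theta alpha tau2 tau4.
Let N := N_ theta alpha tau2.
Hypothesis M_lt1 : spectral_radius M < 1.

Notation xterm := (Xterm theta alpha eps eta).
Notation xsum := (Xsum theta alpha eps eta).
Notation X := (X_ theta alpha eps eta).
Notation gammaX := (gamma_ theta alpha tau2 tau4 sigma2).

Let meps t : measurable_fun setT (eps t) := zI.1 (true, t).
Let meta t : measurable_fun setT (eta t) := zI.1 (false, t).

Let v n := xsum_sq_moments theta alpha sigma2 tau2 tau4 n.

Lemma Xterm_sq_mean t k :
  has_mean P (fun w => xterm t w k ^+ 2) (sigma2 * (M ^+ k *m U0) 0 0).
Proof.
have := has_moments_mean (Xterm_moments theta alpha zI eps_mean eta_mean t k).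
by rewrite mxE.
Qed.

Lemma theta_prod_sq_mean t k :
  has_mean P (fun w => theta_prod theta alpha eta t k w ^+ 2) ((M ^+ k *m U0) 0 0).
Proof.
exact: has_moments_mean (theta_prod_moments theta alpha zI eps_mean eta_mean t k).
Qed.

Lemma theta_prod_sq_mean_cvg0 : (fun k => (M ^+ k *m U0) 0 0) @ \oo --> 0.
Proof.
have [C [rho [_ rho01 H]]] := @mulmx_geometric _ _ _ M 1%:M U0 0 M_lt1.
by apply: (geometric_cvg0 rho01) => k; have := H k; rewrite mul1mx; exact.
Qed.

Definition envelope (q : R) (t : int) (w : T) : \bar R :=
  (\sum_(k <oo) (xterm t w k ^+ 2 / q ^+ k)%:E)%E.

Lemma envelope_integrable : exists2 q : R, 0 < q < 1 &
  forall t, P.-integrable setT (envelope q t).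
Proof.
have [C [rho [C0 /andP[r0 r1] H]]] := @mulmx_geometric _ _ _ M 1%:M U0 0 M_lt1.
(* Any q strictly between rho and 1 works: the expected terms of the envelope are then of order (rho
   / q)^k. *)
pose q := (1 + rho) / 2.
have q0 : 0 < q by rewrite /q; lra.
have q1 : q < 1 by rewrite /q; lra.
have rq : rho < q by rewrite /q; lra.
exists q; first exact/andP.
move=> t.
have ge0 k w : (0 <= (xterm t w k ^+ 2 / q ^+ k)%:E)%E.
  by rewrite lee_fin divr_ge0 ?sqr_ge0// exprn_ge0// ltW.
have mk k : measurable_fun setT (fun w => (xterm t w k ^+ 2 / q ^+ k)%:E).
  apply/measurable_EFinP; apply: measurable_funM; last exact: measurable_cst.
  by apply: measurable_funX; exact: measurable_Xterm.
have menv : measurable_fun setT (envelope q t).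
  by apply: (@ge0_emeasurable_sum _ _ _ _ _ xpredT) => // k w _ _; exact: ge0.
apply/integrableP; split=> //.
under eq_integral do rewrite gee0_abs ?nneseries_ge0//.
rewrite integral_nneseries//.
apply: (@le_lt_trans _ _ (sigma2 * C * (1 - rho / q)^-1)%:E); last exact: ltry.
apply: lime_le.
  by apply: is_cvg_nneseries => k _ _; apply: integral_ge0 => w _; exact: ge0.
apply: nearW => n.
have E k : (\int[P]_w (xterm t w k ^+ 2 / q ^+ k)%:E)%E =
    ((q ^+ k)^-1 * (sigma2 * (M ^+ k *m U0) 0 0))%:E.
  have [_ <-] := has_meanZ (q ^+ k)^-1 (Xterm_sq_mean t k).
  by apply: eq_integral => w _; rewrite mulrC.
under eq_bigr do rewrite E.
rewrite sumEFin lee_fin.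
apply: (@le_trans _ _ (sigma2 * C * \sum_(0 <= k < n) (rho / q) ^+ k)).
  rewrite mulr_sumr; apply: ler_sum => k _.
  have Hk : (M ^+ k *m U0) 0 0 <= C * rho ^+ k.
    by have := H k; rewrite mul1mx; apply: le_trans; exact: ler_norm.
  have sq : 0 <= sigma2 / q ^+ k by rewrite divr_ge0 ?exprn_ge0 ?ltW.
  have -> : sigma2 * C * (rho / q) ^+ k = sigma2 / q ^+ k * (C * rho ^+ k).
    by rewrite expr_div_n; ring.
  by rewrite mulrCA mulrA ler_wpM2l.
apply: ler_wpM2l; first by rewrite mulr_ge0 ?ltW.
by apply: geometric_sum_le; rewrite divr_ge0 ?ltW//= ltr_pdivrMr// mul1r.
Qed.

Section Envelope.
Variable q : R.
Hypothesis q01 : 0 < q < 1.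
Hypothesis env_int : forall t, P.-integrable setT (envelope q t).

Let K := (1 - q)^-1.

Lemma envelope_fin t : {ae P, forall w, envelope q t w \is a fin_num}.
Proof. by apply: filterS (integrable_ae measurableT (env_int t)) => w; exact. Qed.

Lemma envelope_summable t w : envelope q t w \is a fin_num ->
  cvgn (series (xterm t w)) /\
  forall n, ((xsum t n w ^+ 2)%:E <= K%:E * envelope q t w)%E.
Proof.
move=> fenv; have /andP[q0 q1] := q01.
have S n : \sum_(0 <= k < n) xterm t w k ^+ 2 / q ^+ k <= fine (envelope q t w).
  rewrite -lee_fin fineK// -sumEFin; apply: nneseries_lim_ge => k _ _.
  by rewrite lee_fin divr_ge0 ?sqr_ge0// exprn_ge0// ltW.
have [cx bx] := weighted_square_summable q01 S.
by split=> // n; rewrite -(fineK fenv) -EFinM lee_fin; exact: bx.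
Qed.

Lemma Xpartial_xsum t w n :
  Xpartial theta alpha eps eta t w n.+1 = xsum t n.+1 w - eps t w.
Proof.
by rewrite /Xpartial /Xsum [in RHS]big_ltn// Xterm0 addrAC subrr add0r.
Qed.

Lemma cvg_xsum t w : envelope q t w \is a fin_num ->
  cvgn (Xpartial theta alpha eps eta t w) /\ xsum t ^~ w @ \oo --> X t w.
Proof.
move=> /envelope_summable[/cvg_ex[l xl] _].
have Xl : Xpartial theta alpha eps eta t w @ \oo --> l - eps t w.
  (* The shift matters: at n = 0 both sums are empty, and the relation [Xpartial_xsum] starts only
     at index 1. *)
  rewrite -cvg_shiftS; under eq_fun do rewrite Xpartial_xsum.
  apply: cvgB; last exact: cvg_cst.
  by rewrite -cvg_shiftS in xl.
split; first by apply/cvg_ex; exists (l - eps t w).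
by rewrite /X_ (cvg_lim _ Xl)// addrC subrK.
Qed.

Lemma Xpartial_cvg t : {ae P, forall w, cvgn (Xpartial theta alpha eps eta t w)}.
Proof. by apply: filterS (envelope_fin t) => w /cvg_xsum[]. Qed.

Lemma X_solution : solution P theta alpha eps eta X.
Proof.
move=> t; apply: filterS2 (envelope_fin t) (envelope_fin (t - 1)) => w.
move=> /cvg_xsum[_ Xt] /cvg_xsum[_ Xt1].
apply: (cvg_unique _ Xt) => //.
rewrite /= -cvg_shiftS; under eq_fun do rewrite xsumS.
by apply: cvgD; [rewrite mulrC; apply: cvgMl|exact: cvg_cst].
Qed.

Lemma X_mean t : has_mean P (X t) 0.
Proof.
(* The dominating function comes from |x| <= 1 + x^2 and the envelope bound on x^2. *)
apply: (@has_mean_dominated_cvg _ _ _ _ (fun n => xsum t n) _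
  (fun w => 1 + K%:E * envelope q t w)%E (cst 0)).
- exact: measurable_X.
- move=> n; have := has_moments_mean (xsum_moments theta alpha zI eps_mean eta_mean t n).
  by rewrite mxE.
- apply: (@integrableD _ _ _ _ _ _ (cst 1%E)) => //.
    exact: finite_measure_integrable_cst.
  exact: integrableZl.
- by apply: filterS (envelope_fin t) => w /cvg_xsum[].
- apply: filterS (envelope_fin t) => w /envelope_summable[_ xb] n.
  apply: le_trans (leeD2l _ (xb n)); rewrite -EFinD lee_fin.
  rewrite -[X in _ + X]real_normK ?num_real//.
  by set s := `|_|; nra.
- exact: cvg_cst.
Qed.

(** Multiplying the affine recursion by the invertible [1%:M - M], which commutes with [M], makes it
    telescope. *)
Lemma xsum_sq_momentsE n :
  v n = sigma2 *: (invmx (1%:M - M) *m (U0 - M ^+ n *m U0)).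
Proof.
have U := spectral_radius_lt1_unitmx M_lt1.
rewrite scalemxAr; apply: (canRL (mulKmx U)).
rewrite /v; elim: n => [|n IH] /=; first by rewrite mulmx0 expr0 mul1mx subrr scaler0.
rewrite mulmxDr mulmxA mulmxBl mul1mx.
have -> : M - M *m M = M *m (1%:M - M) by rewrite mulmxBr mulmx1.
rewrite -mulmxA IH -scalemxAr -scalemxAr -scalerDr mulmxBl mul1mx mulmxBr.
rewrite mulmxA -[M *m M ^+ n]/(M * M ^+ n) -exprS.
by congr (_ *: _); rewrite addrC addrA subrK.
Qed.

(** By the closed form of [v n], the distance to the limit is an entry of a fixed matrix times
    [M ^+ n *m U0], which decays geometrically. *)
Lemma cross_moment_cvg h :
  (fun n => (N ^+ h *m v n) 0 0) @ \oo --> gammaX h%:Z.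
Proof.
set B := N ^+ h *m invmx (1%:M - M).
have [C [rho [_ rho01 H]]] := @mulmx_geometric _ _ _ M B U0 0 M_lt1.
have B0 := geometric_cvg0 rho01 H.
have L (a : R) (x y : 'cV[R]_3) : (a *: (x - y)) 0 0 = a * x 0 0 - a * y 0 0.
  by rewrite !mxE mulrBr.
have E n : (N ^+ h *m v n) 0 0 = gammaX h%:Z - sigma2 * (B *m (M ^+ n *m U0)) 0 0.
  by rewrite xsum_sq_momentsE -scalemxAr [N ^+ h *m _]mulmxA -/B [B *m _]mulmxBr L.
have -> : gammaX h%:Z = gammaX h%:Z - sigma2 * 0 by rewrite mulr0 subr0.
under eq_fun do rewrite E.
by apply: cvgB; [exact: cvg_cst|exact: cvgMr].
Qed.

Lemma X_cross_mean t (h : nat) :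
  has_mean P (fun w => X t w * X (t + h%:Z) w) (gammaX h%:Z).
Proof.
pose t' := t + h%:Z.
(* The two truncation levels are those of [xsum_cross_moments]; |a b| <= a^2 + b^2 gives the
   dominating function. *)
apply: (@has_mean_dominated_cvg _ _ _ _ (fun n w => xsum t n w * xsum t' (n + h) w) _
  (fun w => K%:E * envelope q t w + K%:E * envelope q t' w)%E
  (fun n => (N ^+ h *m v n) 0 0)).
- by apply: measurable_funM; exact: measurable_X.
- move=> n.
  exact: has_moments_mean (xsum_cross_moments theta alpha zI eps_mean eta_mean t n h).
- by apply: integrableD => //; exact: integrableZl.
- apply: filterS2 (envelope_fin t) (envelope_fin t') => w.
  move=> /cvg_xsum[_ Xt] /cvg_xsum[_ Xt'].
  by rewrite -(cvg_shiftn h) in Xt'; exact: cvgM.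
- apply: filterS2 (envelope_fin t) (envelope_fin t') => w.
  move=> /envelope_summable[_ xb] /envelope_summable[_ xb'] n.
  apply: le_trans (leeD (xb n) (xb' (n + h)%N)).
  rewrite -EFinD lee_fin normrM.
  rewrite -[X in X + _]real_normK ?num_real// -[X in _ + X]real_normK ?num_real//.
  by set a := `|_|; set b := `|_|; nra.
- exact: cross_moment_cvg.
Qed.

(** The variance is the limit of the second moments of the truncations. From n = 1 on, each of these
    is sigma2 plus the mean of a square. *)
Lemma gamma0_gt0 : 0 < gammaX 0.
Proof.
apply: lt_le_trans sigma2_gt0 _.
have c := @cross_moment_cvg 0.
rewrite -(cvg_lim _ c)//; apply: limr_ge; first by apply/cvg_ex; exists (gammaX 0).
exists 1%N => // -[//|n] _ /=.
rewrite expr0 mul1mx /v /= -/(xsum_sq_moments _ _ _ _ _ n) mxE.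
have H := has_moments_theta2 theta alpha zI eps_mean eta_mean
  (depends_onX 2 (@depends_on_past_xsum _ _ _ theta alpha eps eta 0 n))
  (xsum_sq_momentsP theta alpha zI eps_mean eta_mean 0 n).
have H0 : 0 <= (M *m v n) 0 0.
  by apply: has_mean_ge0 (has_moments_mean H) => w; rewrite mulr_ge0// sqr_ge0.
rewrite [X in _ <= _ + X]mxE [U0 0 0]mxE /= mulr1.
by rewrite lerDr.
Qed.

End Envelope.

End SquareIntegrableLimit.

(** * Stationary solutions *)

Section SecondMoments.
Context {R : realType} {d : measure_display} {T : measurableType d}.
Variable P : probability T R.

Lemma sqr_integrable_Lfun2 (f : T -> R) : measurable_fun setT f ->
  P.-integrable setT (EFin \o (fun w => f w ^+ 2)) -> f \in Lfun P 2%:E.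
Proof.
move=> mf /integrableP[_ fi]; rewrite inE; apply/andP; split; rewrite inE//=.
rewrite /finite_norm unlock/= poweR_lty//; apply: le_lt_trans fi.
rewrite le_eqVlt; apply/orP; left; apply/eqP; apply: eq_integral => w _ /=.
by rewrite powR_mulrn// normrX.
Qed.

Lemma covariance_has_mean (Y Z : T -> R) c : has_mean P Y 0 -> has_mean P Z 0 ->
  has_mean P (fun w => Y w * Z w) c -> covariance P Y Z = c%:E.
Proof.
move=> Y0 Z0 YZ; rewrite covarianceE ?(has_mean_Lfun1 Y0) ?(has_mean_Lfun1 Z0)//.
  rewrite [X in (X - _)%E](has_mean_expectation YZ).
  by rewrite (has_mean_expectation Y0) mul0e sube0.
exact: has_mean_Lfun1 YZ.
Qed.

Lemma stationary_mean (W : int -> T -> R) (f : R -> R) a s t :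
  strictly_stationary P W -> measurable_fun setT f ->
  has_mean P (f \o W s) a -> has_mean P (f \o W t) a.
Proof.
move=> [mW sW] mf; apply: has_mean_same_law => // A mA.
have := sW (t - s) _ (measurable_coordinate s mA).
rewrite /preimage/= /trajectory/= => /esym.
by rewrite /path_shift/= addrC subrK.
Qed.

(** The integral of the absolute value of [f] is below every positive e, hence zero. *)
Lemma ae_eq0_of_abs_bounds (f : T -> R) : measurable_fun setT f ->
  (forall e : R, 0 < e -> exists g a, [/\ forall w, 0 <= g w, has_mean P g a,
    a <= e & {ae P, forall w, `|f w| <= g w}]) ->
  {ae P, forall w, f w = 0}.
Proof.
move=> mf fg.
have mEf : measurable_fun setT (EFin \o f) by exact/measurable_EFinP.
suff f0 : (\int[P]_w `|(EFin \o f) w| = 0)%E.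
  have := (ae_eq_integral_abs P measurableT mEf).1 f0.
  by apply: filterS => w /(_ Logic.I) [].
apply/eqP; rewrite eq_le integral_ge0// andbT.
apply/lee_addgt0Pr => e /fg[g [a [g0 ga ae fge]]]; rewrite add0e.
rewrite (@le_trans _ _ a%:E) ?lee_fin// -ga.2.
apply: ae_ge0_le_integral => //.
- exact: measurableT_comp.
- by move=> w _; rewrite lee_fin.
- by apply/measurable_EFinP; exact: has_mean_measurable ga.
- by apply: filterS fge => w H _; rewrite lee_fin.
Qed.

End SecondMoments.

Section StationarySolution.
Context {R : realType} {d : measure_display} {T : measurableType d}.
Variables (P : probability T R) (theta alpha : R) (eps eta : int -> T -> R).
Variables (W V : int -> T -> R).
Hypothesis W_sol : solution P theta alpha eps eta W.
Hypothesis V_sol : solution P theta alpha eps eta V.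

(** The noise cancels in the difference of two solutions, which therefore obeys the homogeneous
    recursion. *)
Lemma solution_diff t k : {ae P, forall w,
  W t w - V t w = theta_prod theta alpha eta t k w * (W (t - k%:Z) w - V (t - k%:Z) w)}.
Proof.
elim: k t => [|k IH] t.
  by apply: aeW => w; rewrite subr0 /theta_prod big_nil mul1r.
apply: filterS3 (W_sol t) (V_sol t) (IH (t - 1)) => w -> -> H; rewrite theta_prodS.
rewrite (_ : t - k.+1%:Z = t - 1 - k%:Z); last by lia.
by rewrite -mulrA -H; ring.
Qed.

(* By [solution_diff], [W t - V t] is a product of coefficients tending to 0 in
   mean square times a term bounded in mean square. *)
Lemma stationary_solution_unique (p : nat -> R) (a b : R) t :
  (forall s, measurable_fun setT (W s)) -> (forall s, measurable_fun setT (V s)) ->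
  (forall k, has_mean P (fun w => theta_prod theta alpha eta t k w ^+ 2) (p k)) ->
  p @ \oo --> 0 ->
  (forall s, has_mean P (fun w => W s w ^+ 2) a) ->
  (forall s, has_mean P (fun w => V s w ^+ 2) b) ->
  {ae P, forall w, W t w = V t w}.
Proof.
move=> mW mV pk p0 Wa Vb.
have a0 : 0 <= a by apply: has_mean_ge0 (Wa t) => w; exact: sqr_ge0.
have b0 : 0 <= b by apply: has_mean_ge0 (Vb t) => w; exact: sqr_ge0.
suff : {ae P, forall w, W t w - V t w = 0}.
  by apply: filterS => w /eqP; rewrite subr_eq0 => /eqP.
apply: ae_eq0_of_abs_bounds; first exact: measurable_funB.
move=> e e0.
(* This is the weight in 2 |u z| <= l u^2 + z^2 / l. It makes the part with a + b at most e / 2, and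
   k is then taken so large that l p(k) is at most e / 2; the added 1 keeps l positive when a = b =
   0. *)
pose l := 4 * (a + b + 1) / e.
have l0 : 0 < l by rewrite divr_gt0// mulr_gt0//; lra.
have l20 : 0 < 2 / l by apply: divr_gt0.
have el0 : 0 < e / 2 / l by apply: divr_gt0 => //; lra.
have /cvgrPdist_le/(_ _ el0)[k _ /(_ k (leqnn k))/=] := p0.
rewrite sub0r normrN => pke.
exists (fun w => l * theta_prod theta alpha eta t k w ^+ 2 +
  2 / l * (W (t - k%:Z) w ^+ 2 + V (t - k%:Z) w ^+ 2)), (l * p k + 2 / l * (a + b)).
split.
- move=> w; apply: addr_ge0; apply: mulr_ge0; rewrite ?sqr_ge0 ?(ltW l0) ?(ltW l20)//.
  by rewrite addr_ge0 ?sqr_ge0.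
- exact: has_meanD (has_meanZ _ (pk k)) (has_meanZ _ (has_meanD (Wa _) (Vb _))).
- have n1 : a + b + 1 != 0 by rewrite gt_eqF//; lra.
  have n2 : e != 0 by rewrite gt_eqF.
  have H1 : l * p k <= e / 2.
    by rewrite mulrC -ler_pdivlMr// (le_trans _ pke)// ler_norm.
  have H2 : 2 / l * (a + b) <= e / 2.
    have -> : 2 / l * (a + b) = (e / 2) * ((a + b) / (a + b + 1)).
      by rewrite /l; field; rewrite n1 n2.
    rewrite -[leRHS]mulr1 ler_wpM2l//; first lra.
    by rewrite ler_pdivrMr; lra.
  lra.
- apply: filterS (solution_diff t k) => w ->.
  set u := theta_prod _ _ _ _ _ _; set x := W _ _; set y := V _ _.
  rewrite normrM.
  have H : 2 * (`|u| * `|x - y|) <= l * u ^+ 2 + (x - y) ^+ 2 / l.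
    rewrite -(real_normK (num_real u)) -(real_normK (num_real (x - y))).
    rewrite -subr_ge0.
    have -> : l * `|u| ^+ 2 + `|x - y| ^+ 2 / l - 2 * (`|u| * `|x - y|) =
       (l * `|u| - `|x - y|) ^+ 2 / l by field; rewrite gt_eqF.
    by rewrite divr_ge0 ?sqr_ge0 ?ltW.
  have H2 : (x - y) ^+ 2 / l <= 2 / l * (x ^+ 2 + y ^+ 2).
    rewrite [leRHS]mulrAC; apply: ler_wpM2r; first by rewrite invr_ge0 ltW.
    rewrite -subr_ge0 (_ : _ - _ = (x + y) ^+ 2) ?sqr_ge0//; ring.
  have : 0 <= `|u| * `|x - y| by rewrite mulr_ge0.
  by move: H H2; set z := `|u| * _; lra.
Qed.

End StationarySolution.

Theorem theorem2p2 (R : realType) (d : measure_display)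
  (Omega : measurableType d) (P : probability Omega R)
  (theta alpha : R) (eps eta : int -> Omega -> R)
  (eps_noise : strong_white_noise P eps)
  (eta_noise : strong_white_noise P eta)
  (eps_eta_indep : independent_processes P eps eta)
  (eps_lnp : ('E_P[fun w => lnp `|eps 0%R w|%R] < +oo)%E)
  (* lne 0 = -oo *)
  (theta_ln :
    (\int[P]_w lne `|theta + alpha * eta 0 w + eta 1 w|%R%:E < 0)%E)
  (eps_odd : odd_moments_zero P (eps 0))
  (eta_odd : odd_moments_zero P (eta 0))
  (sigma2_gt0 : (0 < moment P (eps 0%R) 2)%E)
  (tau2_gt0 : (0 < moment P (eta 0%R) 2)%E)
  (sigma2_fin : (moment P (eps 0%R) 2 < +oo)%E)
  (tau4_fin : (moment P (eta 0%R) 4 < +oo)%E) :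
  let sigma2 := fine (moment P (eps 0) 2) in
  let tau2 := fine (moment P (eta 0) 2) in
  let tau4 := fine (moment P (eta 0) 4) in
  let X := X_ theta alpha eps eta in
  let gammaX := gamma_ theta alpha tau2 tau4 sigma2 in
  spectral_radius (M_ theta alpha tau2 tau4) < 1 ->
  [/\ (forall t : int, {ae P, forall w,
         cvgn (Xpartial theta alpha eps eta t w)}),
      [/\ strictly_stationary P X, second_order_stationary P X,
          (forall t : int, ('E_P[X t] = 0)%E) &
          (forall t h : int,
             covariance P (X t) (X (t + h)) = (gammaX h)%:E)],
      gammaX 0 != 0 /\
      (forall t h : int,
         correlation P (X t) (X (t + h)) = gammaX h / gammaX 0),
      [/\ solution P theta alpha eps eta X, causal P eps eta X &
          ergodic P X] &
      (forall W : int -> Omega -> R,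
         solution P theta alpha eps eta W -> causal P eps eta W ->
         ergodic P W -> strictly_stationary P W ->
         second_order_stationary P W ->
         forall t : int, {ae P, forall w, W t w = X t w})].
Proof.
move=> sigma2 tau2 tau4 X gammaX M_lt1.
have zI := noise_independent_family eps_noise eta_noise eps_eta_indep.
have s2gt0 : 0 < sigma2 by rewrite fine_gt0// sigma2_gt0 sigma2_fin.
have eps_mean t n : (n <= 2)%N ->
    has_mean P (fun w => eps t w ^+ n) [:: 1; 0; sigma2]`_n.
  move=> n2.
  have := white_noise_moments eps_noise eps_odd (isT : ~~ odd 2) sigma2_fin t n2.
  by case: n n2 => [|[|[|//]]].
have eta_mean t n : (n <= 4)%N ->
    has_mean P (fun w => eta t w ^+ n) [:: 1; 0; tau2; 0; tau4]`_n.
  move=> n4.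
  have := white_noise_moments eta_noise eta_odd (isT : ~~ odd 4) tau4_fin t n4.
  by case: n n4 => [|[|[|[|[|//]]]]].
have [q q01 env] := envelope_integrable zI eps_mean eta_mean s2gt0 M_lt1.
have X0 t := X_mean zI eps_mean eta_mean q01 env t.
have XX t h := X_cross_mean zI eps_mean eta_mean M_lt1 q01 env t h.
have g0 := gamma0_gt0 zI eps_mean eta_mean s2gt0 M_lt1.
have cov t h : covariance P (X t) (X (t + h)) = (gammaX h)%:E.
  case: (intP h) => [|n|n].
  - exact: covariance_has_mean (X0 _) (X0 _) (XX t 0%N).
  - exact: covariance_has_mean (X0 _) (X0 _) (XX t n.+1).
  (* For a negative lag the cross moment is taken from the earlier time t - (n + 1), and the
     covariance is symmetric. *)
  - have := covariance_has_mean (X0 _) (X0 _) (XX (t - n.+1%:Z) n.+1).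
    by rewrite subrK covarianceC => ->; rewrite /gammaX /gamma_ abszN.
have mX t := has_mean_measurable (X0 t).
have X2 t : has_mean P (fun w => X t w ^+ 2) (gammaX 0).
  by apply: (eq_has_mean (XX t 0%N)) => w; rewrite addr0.
have Xsol := X_solution q01 env.
split.
- exact: Xpartial_cvg q01 env.
- split.
  + exact: X_strictly_stationary.
  + split=> [t|s t|s t h]; last by rewrite !cov.
      exact: sqr_integrable_Lfun2 (mX t) (X2 t).1.
    by rewrite (has_mean_expectation (X0 s)) (has_mean_expectation (X0 t)).
  + by move=> t; exact: has_mean_expectation (X0 t).
  + exact: cov.
- split=> [|t h]; first by rewrite gt_eqF.
  have var s : fine (variance P (X s)) = gammaX 0.
    by have := cov s 0; rewrite addr0 /variance => ->.
  by rewrite /correlation cov !var -expr2 sqr_sqrtr// ltW.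
- split; [exact: Xsol|exact: X_causal|exact: X_ergodic].
- move=> W Wsol _ _ Wstat [W2 _ _] t.
  (* The second moment of [W] at time 0 is finite; strict stationarity carries it to all times,
     which is the uniform bound that uniqueness requires. *)
  have W0 := integrable_has_mean (Lfun2_integrable_sqr (W2 0)).
  have Wa s := stationary_mean (f := fun x => x ^+ 2) s Wstat
    (measurable_funX 2 (@measurable_id _ _ setT)) W0.
  apply: (stationary_solution_unique Wsol Xsol Wstat.1 mX
    (theta_prod_sq_mean theta alpha zI eps_mean eta_mean t) _ Wa X2).
  exact: theta_prod_sq_mean_cvg0.
Qed.
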